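(* For $G=\mathrm{Hei}\rtimes\mathbb{Z}/4$ there are isomorphisms $$H_n(G)\cong\mathbb{Z}/2\times\mathbb{Z}/4\ \text{ for } n\ge 1,\ n\ne 2,3;\qquad H_2(G)\cong\mathbb{Z}/2;\qquad H_3(G)\cong\mathbb{Z}\times\mathbb{Z}/2\times\mathbb{Z}/4.$$ Moreover, the map $H_3(\mathrm{Hei})\to H_3(G)/\mathrm{tors}(H_3(G))$ induced by the inclusion $\mathrm{Hei}\subseteq G$ is an isomorphism.
   Context: $\mathrm{Hei}=\langle u,v,z\mid [u,z]=1,[v,z]=1,[u,v]=z\rangle$ is the three-dimensional discrete Heisenberg group and $G=\mathrm{Hei}\rtimes\mathbb{Z}/4=\langle u,v,z,t\mid [u,z]=[v,z]=[t,z]=t^4=1,\ [u,v]=z,\ tut^{-1}=v,\ tvt^{-1}=u^{-1}\rangle$. $H_n$ denotes integral group homology and $\mathrm{tors}(A)$ is the torsion subgroup of an abelian group $A$. *)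

(* Defs.v *)
From HB Require Import structures.
From mathcomp Require Import all_boot all_order all_algebra.
From mathcomp Require Import boolp.
From mathcomp Require Import freeg zify ring.

Set Implicit Arguments.
Unset Strict Implicit.
Unset Printing Implicit Defensive.

Import GRing.Theory.

Local Open Scope ring_scope.
Local Open Scope quotient_scope.

Definition zmod_iso (A B : zmodType) : Prop :=
  exists f : {additive A -> B}, bijective f.

Definition torsion (A : zmodType) : {pred A} :=
  [pred x | `[< exists m : nat, (0 < m)%N /\ x *+ m = 0 >]].

Arguments torsion A : clear implicits.

Lemma torsion_zmod_closed (A : zmodType) : zmod_closed (torsion A).
Proof.
split=> [|x y]; first by apply/asboolP; exists 1%N; rewrite mul0rn.
move=> /asboolP[m [m_gt0 xm]] /asboolP[k [k_gt0 yk]]; apply/asboolP.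
exists (m * k)%N; split; first by rewrite muln_gt0 m_gt0.
by rewrite mulrnBl mulrnA xm mul0rn mulnC mulrnA yk mul0rn subrr.
Qed.

HB.instance Definition _ (A : zmodType) :=
  GRing.isZmodClosed.Build A (torsion A) (@torsion_zmod_closed A).

Definition mod_torsion (A : zmodType) : zmodType := Quotient.quot (torsion A).

Definition to_mod_torsion (A : zmodType) (x : A) : mod_torsion A :=
  \pi_(Quotient.quot (torsion A)) x.

Lemma to_mod_torsion_is_zmod_morphism (A : zmodType) :
  zmod_morphism (@to_mod_torsion A).
Proof. by move=> x y; rewrite /to_mod_torsion !piE. Qed.

HB.instance Definition _ (A : zmodType) :=
  GRing.isZmodMorphism.Build A (mod_torsion A) (@to_mod_torsion A)
    (@to_mod_torsion_is_zmod_morphism A).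

(** [H_n(G)] is the homology of the (inhomogeneous, unnormalised) bar complex
    with trivial coefficients: [C_n] is free abelian on [G^n] and
<<
      d [g_1|...|g_n] = [g_2|...|g_n]
         + \sum_(0 < i < n) (-1)^i [g_1|...|g_i g_(i+1)|...|g_n]
         + (-1)^n [g_1|...|g_(n-1)]
>>                                                                            *)

Notation chain G n := {freeg (n.-tuple G) / int}.

Lemma freeg_additive_ext (K : choiceType) (M : zmodType)
    (p q : {additive {freeg K / int} -> M}) :
  (forall x : K, p << x >> = q << x >>) -> p =1 q.
Proof.
move=> pq D; rewrite -(freeg_sumE D) !raddf_sum; apply: eq_bigr => x _ /=.
by rewrite -[coeff x D]intz -freegU_mulz !raddfMz pq.
Qed.

Section BarComplex.
Variable G : groupType.

(** The [i]-th face, [0 <= i <= n.+1], of an [n.+1]-simplex; tuples are indexed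
    from 0, so the face [0 < i <= n] multiplies the entries [i.-1] and [i].    *)
Definition bar_face n (i : nat) (g : n.+1.-tuple G) : n.-tuple G :=
  [tuple let x := tnth g (widen_ord (leqnSn n) j) in
         let y := tnth g (fintype.lift ord0 j) in
         if (j.+1 < i)%N then x else if j.+1 == i then (x * y)%g else y
   | j < n].

Definition bar_d n : chain G n.+1 -> chain G n :=
  fglift (fun g : n.+1.-tuple G =>
            \sum_(i < n.+2) (-1) ^+ i *: (<< bar_face i g >> : chain G n)).

Lemma bar_d_is_zmod_morphism n : zmod_morphism (@bar_d n).
Proof. by move=> x y; exact: lift_is_additive. Qed.

HB.instance Definition _ n :=
  GRing.isZmodMorphism.Build (chain G n.+1) (chain G n) (@bar_d n)
    (@bar_d_is_zmod_morphism n).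

Lemma bar_dU n k (g : n.+1.-tuple G) :
  bar_d << k *g g >> =
  k *: \sum_(i < n.+2) (-1) ^+ i *: (<< bar_face i g >> : chain G n).
Proof. exact: liftU. Qed.

(** The differential leaving degree 0 is zero.                                *)
Definition bar_cycle n : {pred chain G n} :=
  match n with
  | 0 => predT
  | m.+1 => [pred c : chain G m.+1 | bar_d c == 0]
  end.

Lemma bar_cycle_zmod_closed n : zmod_closed (@bar_cycle n).
Proof.
case: n => [|n]; first by [].
split=> [|x y]; rewrite !inE ?raddf0 //.
by move=> /eqP xc /eqP yc; rewrite raddfB /= xc yc subrr.
Qed.

HB.instance Definition _ n :=
  GRing.isZmodClosed.Build (chain G n) (@bar_cycle n)
    (@bar_cycle_zmod_closed n).

Record cycles n : Type := Cycle {
  cycle_val :> chain G n;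
  _ : cycle_val \in @bar_cycle n
}.

HB.instance Definition _ n := [isSub for @cycle_val n].
HB.instance Definition _ n := [Choice of cycles n by <:].
HB.instance Definition _ n := [SubChoice_isSubZmodule of cycles n by <:].

Definition bar_boundary n : {pred cycles n} :=
  [pred c : cycles n | `[< exists b : chain G n.+1, bar_d b = val c >]].

Lemma bar_boundary_zmod_closed n : zmod_closed (@bar_boundary n).
Proof.
split=> [|x y]; first by apply/asboolP; exists 0; rewrite !raddf0.
move=> /asboolP[b xb] /asboolP[c yc]; apply/asboolP.
by exists (b - c); rewrite !raddfB /= xb yc.
Qed.

HB.instance Definition _ n :=
  GRing.isZmodClosed.Build (cycles n) (@bar_boundary n)
    (@bar_boundary_zmod_closed n).

Definition homology n : zmodType := Quotient.quot (@bar_boundary n).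

End BarComplex.

Arguments bar_face {G n} i g.
Arguments bar_d {G n}.
Arguments bar_cycle G n : clear implicits.
Arguments bar_boundary G n : clear implicits.

Section BarComplexSquare.
Variable G : groupType.

Definition face_fun (i : nat) (h : nat -> G) (k : nat) : G :=
  if (k.+1 < i)%N then h k else if k.+1 == i then (h k * h k.+1)%g else h k.+1.

Lemma face_funE n i (g : n.+1.-tuple G) (h : nat -> G) :
  (forall j : 'I_n.+1, tnth g j = h j) ->
  forall j : 'I_n, tnth (bar_face i g) j = face_fun i h j.
Proof. by move=> gh j; rewrite tnth_mktuple !gh. Qed.

Lemma face_fun_face (i j : nat) h k : (j < i)%N ->
  face_fun j (face_fun i h) k = face_fun i.-1 (face_fun j h) k.
Proof.
rewrite /face_fun; case: i => // i lt_ji /=.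
by repeat (case: ltnP || case: eqP) => //= *; rewrite ?mulgA //; try lia.
Qed.

Lemma bar_face_face n i j (g : n.+2.-tuple G) : (j < i)%N ->
  bar_face j (bar_face i g) = bar_face i.-1 (bar_face j g).
Proof.
move=> lt_ji; apply: eq_from_tnth => k.
have gh (l : 'I_n.+2) : tnth g l = nth 1%g g l by rewrite (tnth_nth 1%g).
rewrite !(face_funE _ (face_funE _ gh)).
exact: face_fun_face.
Qed.

Lemma simplicial_sum0 (V : lmodType int) N (a : nat -> nat -> V) :
  (forall i j, (j < i)%N -> a i j = a j i.-1) ->
  \sum_(i < N.+1) (-1) ^+ i *: (\sum_(j < N) (-1) ^+ j *: a i j) = 0.
Proof.
move=> aE.
have -> : \sum_(i < N.+1) (-1) ^+ i *: (\sum_(j < N) (-1) ^+ j *: a i j) =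
  \sum_(i < N.+1) \sum_(j < N | (j < i)%N) (-1) ^+ (i + j) *: a i j +
  \sum_(i < N.+1) \sum_(j < N | (i <= j)%N) (-1) ^+ (i + j) *: a i j.
  rewrite -big_split; apply: eq_bigr => i _.
  rewrite scaler_sumr (bigID (fun j : 'I_N => (j < i)%N)) /=.
  congr (_ + _); apply: eq_big => [j|j _]; rewrite ?scalerA ?exprD //.
  by rewrite -leqNgt.
rewrite big_ord_recl big_pred0 // add0r big_ord_recr /=.
rewrite [X in _ + (_ + X)]big_pred0 ?addr0 => [|j]; last by rewrite leqNgt ltn_ord.
rewrite [X in _ + X](exchange_big_dep xpredT) //= -big_split big1 // => i _ /=.
rewrite -[RHS](subrr (\sum_(j < N | (j <= i)%N) (-1) ^+ (i + j) *: a j i)) addrC.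
congr (_ + _); first by apply: eq_bigr => j _; rewrite addnC.
rewrite -sumrN; apply: eq_bigr => j le_ji.
by rewrite aE //= addSn exprS mulN1r scaleNr.
Qed.

Lemma bar_dd n (c : chain G n.+2) : bar_d (bar_d c) = 0.
Proof.
have: @bar_d G n \o @bar_d G n.+1 =1 (\0 : {additive _ -> _}); last exact.
apply: freeg_additive_ext => g /=; rewrite bar_dU scale1r raddf_sum.
rewrite -[RHS](@simplicial_sum0 (chain G n) n.+2
  (fun i j => << bar_face j (bar_face i g) >>)).
  apply: eq_bigr => i _; by rewrite raddfZsign /= bar_dU scale1r.
by move=> i j lt_ji; rewrite bar_face_face.
Qed.
End BarComplexSquare.

Section HomologyMap.
Variables (G K : groupType) (f : {multiplicative G -> K}).

Definition chain_map n : chain G n -> chain K n :=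
  fglift (fun g : n.-tuple G => << map_tuple f g >> : chain K n).

Lemma chain_map_is_zmod_morphism n : zmod_morphism (@chain_map n).
Proof. by move=> x y; exact: lift_is_additive. Qed.

HB.instance Definition _ n :=
  GRing.isZmodMorphism.Build (chain G n) (chain K n) (@chain_map n)
    (@chain_map_is_zmod_morphism n).

Lemma chain_mapU n k (g : n.-tuple G) :
  chain_map << k *g g >> = << k *g map_tuple f g >>.
Proof.
rewrite [LHS]liftU; apply/eqP/freeg_eqP => x.
by rewrite coeffZ !coeffU mul1r.
Qed.

Lemma map_bar_face n i (g : n.+1.-tuple G) :
  map_tuple f (bar_face i g) = bar_face i (map_tuple f g).
Proof.
apply: eq_from_tnth => j; rewrite tnth_map !tnth_mktuple !tnth_map.
by case: ltnP => // _; case: eqP => // _; apply: gmulfM.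
Qed.

Lemma bar_d_chain_map n (c : chain G n.+1) :
  bar_d (chain_map c) = chain_map (bar_d c).
Proof.
have: bar_d \o @chain_map n.+1 =1 @chain_map n \o bar_d; last exact.
apply: freeg_additive_ext => g /=; rewrite chain_mapU !bar_dU !scale1r raddf_sum.
by apply: eq_bigr => i _; rewrite raddfZsign /= chain_mapU map_bar_face.
Qed.

Lemma chain_map_cycle n (c : cycles G n) : chain_map c \in bar_cycle K n.
Proof.
case: n c => [//|n] [c /=]; rewrite !inE => /eqP dc.
by rewrite bar_d_chain_map dc raddf0.
Qed.

Definition cycle_map n (c : cycles G n) : cycles K n := Cycle (chain_map_cycle c).

Lemma cycle_map_is_zmod_morphism n : zmod_morphism (@cycle_map n).
Proof. by move=> x y; apply: val_inj; rewrite /= !raddfB. Qed.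

HB.instance Definition _ n :=
  GRing.isZmodMorphism.Build (cycles G n) (cycles K n) (@cycle_map n)
    (@cycle_map_is_zmod_morphism n).

Definition homology_map n (h : homology G n) : homology K n :=
  \pi_(Quotient.quot (bar_boundary K n)) (cycle_map (repr h)).

Lemma homology_map_pi n (c : cycles G n) :
  homology_map (\pi_(Quotient.quot (bar_boundary G n)) c) =
  \pi_(Quotient.quot (bar_boundary K n)) (cycle_map c).
Proof.
apply/eqP; rewrite -Quotient.idealrBE -raddfB.
have: repr (\pi_(Quotient.quot (bar_boundary G n)) c) - c \in bar_boundary G n.
  by rewrite Quotient.idealrBE reprK.
move=> /asboolP[b db]; apply/asboolP; exists (chain_map b).
by rewrite bar_d_chain_map db.
Qed.

Lemma homology_map_is_zmod_morphism n : zmod_morphism (@homology_map n).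
Proof.
by elim/quotW=> x; elim/quotW=> y; rewrite -[_ - _]raddfB !homology_map_pi !raddfB.
Qed.

HB.instance Definition _ n :=
  GRing.isZmodMorphism.Build (homology G n) (homology K n) (@homology_map n)
    (@homology_map_is_zmod_morphism n).

End HomologyMap.

Arguments chain_map {G K} f n c.
Arguments cycle_map {G K} f n c.
Arguments homology_map {G K} f n h.

(** The letter [(x, true)] stands for [x], the letter [(x, false)] for [x^-1]. *)
Definition word (X : Type) := seq (X * bool).

Section Words.
Variable X : Type.
Implicit Types v w : word X.

Definition wgen (x : X) : word X := [:: (x, true)].
Definition winv w : word X := rev [seq (l.1, ~~ l.2) | l <- w].
Definition wcomm v w : word X := v ++ w ++ winv v ++ winv w.

End Words.

Section Presentation.
Variables (X : choiceType) (rels : seq (word X * word X)).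

Inductive word_eq : word X -> word X -> Prop :=
| word_eq_refl w : word_eq w w
| word_eq_sym v w : word_eq v w -> word_eq w v
| word_eq_trans v w1 w2 : word_eq v w1 -> word_eq w1 w2 -> word_eq v w2
| word_eq_cat v1 v2 w1 w2 :
    word_eq v1 w1 -> word_eq v2 w2 -> word_eq (v1 ++ v2) (w1 ++ w2)
| word_eq_cancel x b : word_eq [:: (x, b); (x, ~~ b)] [::]
| word_eq_rel r : r \in rels -> word_eq r.1 r.2.

Definition word_eqb : rel (word X) := fun v w => `[< word_eq v w >].

Lemma word_eqb_equiv : equiv_class_of word_eqb.
Proof.
split=> [w|v w|w v u].
- exact/asboolP/word_eq_refl.
- by apply/asboolP/asboolP; apply: word_eq_sym.
- by move=> /asboolP vw /asboolP wu; apply/asboolP/(word_eq_trans vw).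
Qed.

Canonical word_eqb_equivRel := EquivRelPack word_eqb_equiv.
Canonical word_eqb_encModRel := defaultEncModRel word_eqb.

Definition presented := {eq_quot word_eqb}.

HB.instance Definition _ : EqQuotient (word X) word_eqb presented :=
  EqQuotient.on presented.
HB.instance Definition _ := Choice.on presented.

Lemma presented_eqP v w :
  \pi_presented v = \pi_presented w <-> word_eq v w.
Proof.
by split=> [/eqP|vw]; last apply/eqP; rewrite piE => *; apply/asboolP.
Qed.

Definition presented_one : presented := \pi_presented [::].
Definition presented_mul (x y : presented) : presented := \pi_presented (repr x ++ repr y).
Definition presented_inv (x : presented) : presented := \pi_presented (winv (repr x)).

Lemma word_eq_repr w : word_eq (repr (\pi_presented w)) w.
Proof. by apply/presented_eqP; rewrite reprK. Qed.

Lemma presented_mulE v w :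
  presented_mul (\pi_presented v) (\pi_presented w) = \pi_presented (v ++ w).
Proof. by apply/presented_eqP/word_eq_cat; apply: word_eq_repr. Qed.

Lemma word_eq_mulV w : word_eq (w ++ winv w) [::].
Proof.
elim: w => [|[x b] w IHw]; first exact: word_eq_refl.
rewrite /winv map_cons rev_cons -cats1 -cat1s.
apply: word_eq_trans (word_eq_cancel x b).
rewrite -[[:: _; _]]/([:: (x, b)] ++ [::] ++ [:: (x, ~~ b)]) -!catA.
apply: word_eq_cat; first exact: word_eq_refl.
by rewrite !catA; apply: word_eq_cat IHw _; apply: word_eq_refl.
Qed.

Lemma winvK : involutive (@winv X).
Proof.
move=> w; rewrite /winv map_rev revK -map_comp -[RHS]map_id.
by apply: eq_map => -[x b] /=; rewrite negbK.
Qed.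

Lemma presented_mulA : associative presented_mul.
Proof.
elim/quotW=> u; elim/quotW=> v; elim/quotW=> w.
rewrite (presented_mulE u v) (presented_mulE v w).
by rewrite (presented_mulE u (v ++ w)) (presented_mulE (u ++ v) w) catA.
Qed.

Lemma presented_mul1 : left_id presented_one presented_mul.
Proof. by move=> x; rewrite -[x]reprK presented_mulE. Qed.

Lemma presented_mulr1 : right_id presented_one presented_mul.
Proof. by move=> x; rewrite -[x]reprK presented_mulE cats0. Qed.

Lemma presented_mulV : right_inverse presented_one presented_inv presented_mul.
Proof.
move=> x; rewrite -[x in presented_mul x _]reprK presented_mulE.
exact/presented_eqP/word_eq_mulV.
Qed.

Lemma presented_mulVl : left_inverse presented_one presented_inv presented_mul.
Proof.
move=> x; rewrite -[x in presented_mul _ x]reprK presented_mulE.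
by apply/presented_eqP; rewrite -[X in _ ++ X]winvK; apply: word_eq_mulV.
Qed.

HB.instance Definition _ := isMonoid.Build presented
  presented_mulA presented_mul1 presented_mulr1.
HB.instance Definition _ := hasInv.Build presented presented_inv.
HB.instance Definition _ := Monoid_isGroup.Build presented
  presented_mulVl presented_mulV.

Definition pgen (x : X) : presented := \pi_presented (wgen x).

Section Lift.
Variables (K : groupType) (f : X -> K).

Definition word_eval (w : word X) : K :=
  (\prod_(l <- w) if l.2 then f l.1 else (f l.1)^-1)%g.

Lemma word_eval_cat v w : word_eval (v ++ w) = (word_eval v * word_eval w)%g.
Proof. exact: big_cat. Qed.

Hypothesis f_rels : forall r, r \in rels -> word_eval r.1 = word_eval r.2.

Lemma word_eval_eq v w : word_eq v w -> word_eval v = word_eval w.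
Proof.
elim=> {v w} //= [v w1 w2 _ -> _ -> //|v1 v2 w1 w2 _ e1 _ e2|x b].
  by rewrite !word_eval_cat e1 e2.
by rewrite /word_eval !big_cons big_nil mulg1; case: b; rewrite ?mulgV ?mulVg.
Qed.

(** The dummy [let] makes the compatibility hypothesis an argument.          *)
Definition presented_lift : presented -> K :=
  let _ := f_rels in fun x => word_eval (repr x).

Lemma presented_lift_pi w : presented_lift (\pi_presented w) = word_eval w.
Proof. exact/word_eval_eq/word_eq_repr. Qed.

Lemma presented_liftM : {morph presented_lift : x y / (x * y)%g}.
Proof.
move=> x y; rewrite -[x]reprK -[y]reprK.
by rewrite [(_ * _)%g]presented_mulE !presented_lift_pi word_eval_cat.
Qed.

HB.instance Definition _ :=
  isMultiplicative.Build presented K presented_lift presented_liftM.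

Lemma presented_lift_gen x : presented_lift (pgen x) = f x.
Proof. by rewrite presented_lift_pi /word_eval big_seq1. Qed.

End Lift.

Lemma word_eval_pgen w : word_eval pgen w = \pi_presented w.
Proof.
elim: w => [|[x b] w IHw]; first exact: big_nil.
rewrite /word_eval big_cons -/(word_eval _ _) IHw -cat1s -presented_mulE.
congr (_ * _)%g; case: b => //=.
by rewrite -[LHS]mul1g; apply/esym/divg1_eq; rewrite mul1g invgK
  [(_ * _)%g]presented_mulE; apply/presented_eqP/word_eq_cancel.
Qed.

End Presentation.

Inductive hei_gen : Type := Hu | Hv | Hz.

HB.instance Definition _ := gen_eqMixin hei_gen.
HB.instance Definition _ := gen_choiceMixin hei_gen.

(** [wcomm v w] is [v w v^-1 w^-1]; since [z] is central, the other convention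
    [v^-1 w^-1 v w] for commutators gives the same two groups.               *)
Definition hei_rels : seq (word hei_gen * word hei_gen) :=
  let u := wgen Hu in let v := wgen Hv in let z := wgen Hz in
  [:: (wcomm u z, [::]); (wcomm v z, [::]); (wcomm u v, z)].

Definition Hei : groupType := presented hei_rels.

Inductive hei4_gen : Type := Gu | Gv | Gz | Gt.

HB.instance Definition _ := gen_eqMixin hei4_gen.
HB.instance Definition _ := gen_choiceMixin hei4_gen.

Definition hei4_rels : seq (word hei4_gen * word hei4_gen) :=
  let u := wgen Gu in let v := wgen Gv in
  let z := wgen Gz in let t := wgen Gt in
  [:: (wcomm u z, [::]); (wcomm v z, [::]); (wcomm t z, [::]);
      (t ++ t ++ t ++ t, [::]); (wcomm u v, z);
      (t ++ u ++ winv t, v); (t ++ v ++ winv t, winv u)].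

Definition Hei4 : groupType := presented hei4_rels.

Definition hei_incl_gen (x : hei_gen) : hei4_gen :=
  match x with Hu => Gu | Hv => Gv | Hz => Gz end.

Definition hei_incl_word (w : word hei_gen) : word hei4_gen :=
  [seq (hei_incl_gen l.1, l.2) | l <- w].

Lemma hei_incl_wordE w :
  word_eval (fun x => pgen hei4_rels (hei_incl_gen x)) w =
  \pi_(presented hei4_rels) (hei_incl_word w).
Proof. by rewrite -word_eval_pgen /word_eval big_map. Qed.

Lemma hei_incl_rels r : r \in hei_rels ->
  word_eval (fun x => pgen hei4_rels (hei_incl_gen x)) r.1 =
  word_eval (fun x => pgen hei4_rels (hei_incl_gen x)) r.2.
Proof.
move=> r_in; rewrite !hei_incl_wordE; apply/presented_eqP.
apply: (@word_eq_rel _ hei4_rels (hei_incl_word r.1, hei_incl_word r.2)).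
by move: r_in; rewrite !inE => /or3P[] /eqP->; rewrite eqxx ?orbT.
Qed.

Definition hei_incl : {multiplicative Hei -> Hei4} :=
  presented_lift hei_incl_rels.

(** The action of [Hei4] on [Hei], identified with the triples [(a, b, c)]
    standing for [u^a v^b z^c]: [Hei] acts by left translation and [t] by
    [t u t^-1 = v], [t v t^-1 = u^-1].                                        *)
Definition hei4_act_letter (l : hei4_gen * bool) (p : int * int * int) :
    int * int * int :=
  let: (a, b, c) := p in
  match l with
  | (Gu, true) => (a + 1, b, c)    | (Gu, false) => (a - 1, b, c)
  | (Gv, true) => (a, b + 1, c - a) | (Gv, false) => (a, b - 1, c + a)
  | (Gz, true) => (a, b, c + 1)    | (Gz, false) => (a, b, c - 1)
  | (Gt, true) => (- b, a, c + a * b) | (Gt, false) => (b, - a, c + a * b)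
  end.

Definition hei4_act (w : word hei4_gen) p := foldr hei4_act_letter p w.

Lemma hei4_act_eq v w : word_eq hei4_rels v w -> hei4_act v =1 hei4_act w.
Proof.
elim=> {v w} //=.
- by move=> v w _ IH p; rewrite IH.
- by move=> v w1 w2 _ IH1 _ IH2 p; rewrite IH1.
- by move=> v1 v2 w1 w2 _ IH1 _ IH2 p; rewrite /hei4_act !foldr_cat -/(hei4_act v2 p) IH2 -/(hei4_act v1 _) IH1.
- by move=> x b [[a1 b1] c1]; case: x; case: b => /=; do ![congr (_, _)]; ring.
move=> r; rewrite !inE.
by do ![case/predU1P=> [->|]] => [p|p|p|p|p|p|/eqP-> p]; case: p => [[a b] c] /=;
  do ![congr (_, _)]; ring.
Qed.

Section NormalForm.
Local Open Scope group_scope.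

Let u := pgen hei_rels Hu.
Let v := pgen hei_rels Hv.
Let z := pgen hei_rels Hz.

Definition zexpg (G : groupType) (x : G) (m : int) : G :=
  match m with Posz k => x ^+ k | Negz k => x ^- k.+1 end.

Lemma zexpgS (G : groupType) (x : G) m : x * zexpg x m = zexpg x (m + 1)%R.
Proof.
case: m => [k|k] /=; first by rewrite -expgS -addn1.
case: k => [|k]; first by rewrite expg1 mulgV.
have ->: (Negz k.+1 + 1)%R = Negz k by lia.
by rewrite /= expgSr invgM mulVKg.
Qed.

Lemma zexpgP (G : groupType) (x : G) m : x^-1 * zexpg x m = zexpg x (m - 1)%R.
Proof. by apply: (mulgI x); rewrite mulVKg zexpgS subrK. Qed.

Lemma zexpg_comm (G : groupType) (x y : G) m :
  commute x y -> commute x (zexpg y m).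
Proof.
by case: m => k xy; [apply: commuteX|apply/commuteV/commuteX].
Qed.

Lemma hei_rel_eval r : r \in hei_rels ->
  word_eval (pgen hei_rels) r.1 = word_eval (pgen hei_rels) r.2.
Proof. by move=> /word_eq_rel r_eq; rewrite !word_eval_pgen; apply/presented_eqP. Qed.

Lemma wcomm_eval x y :
  word_eval (pgen hei_rels) (wcomm (wgen x) (wgen y)) =
  pgen hei_rels x * pgen hei_rels y * (pgen hei_rels x)^-1 * (pgen hei_rels y)^-1.
Proof. by rewrite /word_eval !big_cons big_nil /= mulg1 !mulgA. Qed.

Lemma hei_comm_uz : commute u z.
Proof.
have := @hei_rel_eval (wcomm (wgen Hu) (wgen Hz), [::]).
rewrite wcomm_eval !inE eqxx => /(_ isT).
by rewrite [RHS]big_nil => /divg1_eq uz; rewrite /commute -[LHS](mulgVK u) uz.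
Qed.
Lemma hei_comm_vz : commute v z.
Proof.
have := @hei_rel_eval (wcomm (wgen Hv) (wgen Hz), [::]).
rewrite wcomm_eval !inE eqxx orbT => /(_ isT).
by rewrite [RHS]big_nil => /divg1_eq uz; rewrite /commute -[LHS](mulgVK v) uz.
Qed.
Lemma hei_comm_vu : v * u = z^-1 * (u * v).
Proof.
have := @hei_rel_eval (wcomm (wgen Hu) (wgen Hv), wgen Hz).
rewrite wcomm_eval !inE eqxx !orbT => /(_ isT).
rewrite [RHS]big_seq1 /= -/u -/v -/z => <-.
by rewrite !invgM !invgK !mulgA mulgVK mulgVK.
Qed.

Definition hei_nf (p : int * int * int) : Hei :=
  let: (a, b, c) := p in zexpg u a * (zexpg v b * zexpg z c).

Lemma hei_commX a : v * zexpg u a = zexpg u a * (v * zexpg z (- a)).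
Proof.
pose P a := v * zexpg u a = zexpg u a * (v * zexpg z (- a)).
have PS m : P m <-> P (m + 1)%R.
  rewrite /P -zexpgS opprD -zexpgP !mulgA hei_comm_vu.
  have zC : commute (zexpg u m * v) z^-1.
    apply/commuteV/commute_sym/commuteM; last exact/commute_sym/hei_comm_vz.
    exact/zexpg_comm/commute_sym/hei_comm_uz.
  have zuC : commute u z^-1 by apply/commuteV/hei_comm_uz.
  rewrite -[u * _ * v in X in _ <-> X]mulgA -[in X in _ <-> X](mulgA u _ z^-1) zC.
  rewrite -!mulgA [X in _ <-> _ = X]mulgA zuC -!mulgA.
  by split=> [->//|/mulgI/mulgI].
have P0 : P 0 by rewrite /P oppr0 /= mul1g mulg1.
by elim/int_rec: a => [//|k /PS|k]; rewrite -?PoszD ?addn1 // => Pk;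
   apply/PS; have -> : (- k.+1%:Z + 1)%R = (- k%:Z)%R by lia.
Qed.

Lemma zexpgD (G : groupType) (x : G) m n :
  zexpg x m * zexpg x n = zexpg x (m + n)%R.
Proof.
pose P a := zexpg x a * zexpg x n = zexpg x (a + n)%R.
have PS a : P a <-> P (a + 1)%R.
  rewrite /P -zexpgS addrAC -zexpgS -mulgA.
  by split=> [->|/mulgI].
have P0 : P 0 by rewrite /P add0r /= mul1g.
by elim/int_rec: m => [//|k /PS|k]; rewrite -?PoszD ?addn1 // => Pk;
   apply/PS; have -> : (- k.+1%:Z + 1)%R = (- k%:Z)%R by lia.
Qed.

Lemma zexpg_comm2 (G : groupType) (x y : G) m n :
  commute x y -> commute (zexpg x m) (zexpg y n).
Proof. by move=> xy; apply/zexpg_comm/commute_sym/zexpg_comm/commute_sym. Qed.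

Lemma hei_nf_gen x p :
  pgen hei_rels x * hei_nf p = hei_nf (hei4_act_letter (hei_incl_gen x, true) p).
Proof.
case: p => [[m n] k]; case: x; rewrite /hei_nf /= -/u -/v -/z.
- by rewrite mulgA zexpgS.
- rewrite mulgA hei_commX -!mulgA (mulgA (zexpg z _)).
  rewrite (zexpg_comm2 _ _ (commute_sym hei_comm_vz)) -mulgA zexpgD (mulgA v) zexpgS.
  by rewrite (addrC (- m)%R).
- rewrite mulgA (zexpg_comm _ (commute_sym hei_comm_uz)) -mulgA.
  by rewrite (mulgA z) (zexpg_comm _ (commute_sym hei_comm_vz)) -mulgA zexpgS.
Qed.

Lemma hei_nf_letter x b p :
  (if b then pgen hei_rels x else (pgen hei_rels x)^-1) * hei_nf p =
  hei_nf (hei4_act_letter (hei_incl_gen x, b) p).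
Proof.
case: b; first exact: hei_nf_gen.
apply: (mulgI (pgen hei_rels x)); rewrite mulVKg hei_nf_gen; congr hei_nf.
by case: p x => [[m n] k] [] /=; do ![congr (_, _)]; ring.
Qed.

Lemma hei_nfE w :
  \pi_(presented hei_rels) w = hei_nf (hei4_act (hei_incl_word w) (0, 0, 0)%R).
Proof.
rewrite -word_eval_pgen; elim: w => [|[x b] w IHw].
  by rewrite /word_eval big_nil /= !mulg1.
by rewrite /word_eval big_cons -/(word_eval _ _) IHw hei_nf_letter.
Qed.
End NormalForm.

Lemma hei_incl_inj : injective hei_incl.
Proof.
elim/quotW=> v; elim/quotW=> w.
rewrite /hei_incl /= (presented_lift_pi hei_incl_rels v) (presented_lift_pi hei_incl_rels w).
rewrite !hei_incl_wordE => /presented_eqP /hei4_act_eq vw.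
by rewrite !hei_nfE vw.
Qed.

(* Main.v *)
(** Homology can be computed from any free resolution with an augmentation, by
    the comparison theorem applied to the bar resolution.  [Hei4] acts on [R^3]
    (the Heisenberg group, fibred over the plane by the lines [<z>]) preserving
    the fibres over the square grid: over vertices, with stabiliser [<t>] x [<z>];
    over edges, with stabiliser [<u t^2>] x [<z>]; over squares, with stabiliser
    [<u t>], which is infinite cyclic because [(u t)^4 = z].  Splicing periodic
    resolutions of these stabilisers gives a free resolution of rank 1, 3, 5, 5,
    4, 4, ..., which is exact in degrees 0 and 1 by Fox calculus on the given
    presentation, in degree 2 because a plane has no closed 2-chain, and
    triangular above.  Its coinvariants have a sparse integer differential from
    which all [H_n] are read off.  Mapping the Koszul-like resolution of length 3
    of [Hei] into it shows that the fundamental class of [Hei] generates [H_3]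
    modulo torsion.                                                           *)

From HB Require Import structures.
From mathcomp Require Import all_boot all_order all_algebra.
From mathcomp Require Import boolp.
From mathcomp Require Import freeg zify ring.
Require Import Defs.

Set Implicit Arguments.
Unset Strict Implicit.
Unset Printing Implicit Defensive.

Import GRing.Theory.

Local Open Scope ring_scope.

(** Identities between matrices over the group ring, such as d d = 0 or the chain map equations, are
    decided by [vm_compute]: entries are combinations of words, and each word is replaced by its
    normal form, u^i v^j z^c t^k in the case of G. Exactness above degree 1 rests on kernels of x -
    1 and of norms for single elements x: finite order is handled by a residue function on the
    group, infinite order by the finiteness of supports. With s = u t^2, the entry [fl true] comes
    from (1 + s)(u - 1) = (1 - u)(t^2 - 1) = (1 - u)(1 + t)(t - 1), which makes (1 - u)(1 + t) the
    lift of u - 1 one degree higher. The cell over a square is what separates low degrees from the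
    rest: on coinvariants it glues a Z/4 and a Z/2 in degree 2 into a single Z/2, and a 3-cycle must
    contain its degree 3 version a multiple of 4 times. The fundamental class of Hei contains it
    exactly -4 times, so although Hei has index 4 in G, the image of this class is not divisible
    modulo torsion. *)

Section LinearExtension.
Variables (K : choiceType) (M : lmodType int) (f : K -> M).

Definition linext : {freeg K / int} -> M := fglift f.

Lemma linext_is_zmod_morphism : zmod_morphism linext.
Proof. by move=> x y; exact: lift_is_additive. Qed.

HB.instance Definition _ :=
  GRing.isZmodMorphism.Build {freeg K / int} M linext linext_is_zmod_morphism.

Lemma linextU x : linext << x >> = f x.
Proof. by rewrite /linext liftU scale1r. Qed.

End LinearExtension.

Lemma additive_scalez (U V : lmodType int) (f : {additive U -> V}) (k : int) u :
  f (k *: u) = k *: f u.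
Proof. by rewrite -[k]intz !scaler_int raddfMz. Qed.

Lemma freeg_additive_ind (K : choiceType) (P : {freeg K / int} -> Prop) :
  P 0 -> (forall x y, P x -> P y -> P (x - y)) -> (forall x, P << x >>) ->
  forall x, P x.
Proof.
move=> P0 PB PU x.
have PD a b : P a -> P b -> P (a + b).
  by move=> Pa Pb; rewrite -[b]opprK -[- b]sub0r; apply/(PB _ _ Pa)/PB.
have PMn a n : P a -> P (a *+ n).
  by move=> Pa; elim: n => [//|n IH]; rewrite mulrS; apply: PD.
rewrite -(freeg_sumE x); elim: (dom x) => [|k s IH]; first by rewrite big_nil.
rewrite big_cons; apply: PD => //.
rewrite -[coeff k x]intz -freegU_mulz.
case: (coeff k x) => n; first exact/PMn/PU.
by rewrite NegzE mulrNz -sub0r; apply: PB => //; apply/PMn/PU.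
Qed.

Section Pushforward.
Variables (K L : choiceType) (f : K -> L).

Definition push : {freeg K / int} -> {freeg L / int} :=
  linext (fun x => << f x >>).

HB.instance Definition _ := GRing.Additive.on push.

Lemma pushU x : push << x >> = << f x >>.
Proof. exact: linextU. Qed.

Lemma coeff_push x a : injective f -> coeff (f x) (push a) = coeff x a.
Proof.
move=> f_inj; move: a; apply: freeg_additive_ind => [|a b Ha Hb|y].
- by rewrite !raddf0.
- by rewrite !raddfB /= Ha Hb.
- by rewrite pushU !coeffU (inj_eq f_inj).
Qed.

End Pushforward.

Lemma push_comp (K L N : choiceType) (f : K -> L) (g : L -> N) a :
  push g (push f a) = push (g \o f) a.
Proof.
move: a; apply: freeg_additive_ind => [|a b Ha Hb|y]; first by rewrite !raddf0.
  by rewrite !raddfB /= Ha Hb.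
by rewrite !pushU.
Qed.

Lemma eq_push (K L : choiceType) (f g : K -> L) : f =1 g -> push f =1 push g.
Proof. by move=> fg; apply: freeg_additive_ext => x /=; rewrite !pushU fg. Qed.

Lemma push_id (K : choiceType) : push (@id K) =1 id.
Proof.
apply: freeg_additive_ind => [|a b Ha Hb|y]; rewrite ?raddf0 ?raddfB ?pushU //=.
by rewrite Ha Hb.
Qed.

(** Free left [G]-modules: [{freeg (G * B) / int}] is free with basis the
    elements [(1, b)].                                                        *)
Section FreeModules.
Variables (G : groupType) (B : choiceType).
Implicit Types (g h : G) (x : {freeg (G * B) / int}).

Definition gact g : {freeg (G * B) / int} -> {freeg (G * B) / int} :=
  push (fun p => ((g * p.1)%g, p.2)).

HB.instance Definition _ g := GRing.Additive.on (gact g).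

Lemma gactU g h b : gact g << (h, b) >> = << ((g * h)%g, b) >>.
Proof. by rewrite /gact pushU. Qed.

Lemma gactM g h x : gact g (gact h x) = gact (g * h) x.
Proof. by rewrite /gact push_comp; apply: eq_push => -[k b] /=; rewrite mulgA. Qed.

Lemma gact1 x : gact 1 x = x.
Proof. by rewrite -[RHS]push_id; apply: eq_push => -[k b] /=; rewrite mul1g. Qed.

Definition coinv : {freeg (G * B) / int} -> {freeg B / int} := push snd.

HB.instance Definition _ := GRing.Additive.on coinv.

Lemma coinvU g b : coinv << (g, b) >> = << b >>.
Proof. exact: pushU. Qed.

Lemma coinv_gact g x : coinv (gact g x) = coinv x.
Proof. by rewrite /coinv /gact push_comp; apply: eq_push. Qed.

End FreeModules.

Lemma group_morph1 (H G : groupType) (phi : {multiplicative H -> G}) :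
  phi 1%g = 1%g.
Proof. by apply: (mulgI (phi 1%g)); rewrite -gmulfM !mulg1. Qed.

(** * Equivariant maps of free modules and their coinvariants *)

Section EquivariantMaps.
Variables (H G : groupType) (phi : {multiplicative H -> G}) (B C : choiceType).
Notation FB := {freeg (H * B) / int}.
Notation FC := {freeg (G * C) / int}.

Definition equivariant (f : FB -> FC) : Prop :=
  forall h x, f (gact h x) = gact (phi h) (f x).

Lemma equivariant_ext (f g : {additive FB -> FC}) :
  equivariant f -> equivariant g ->
  (forall b, f << (1%g, b) >> = g << (1%g, b) >>) -> f =1 g.
Proof.
move=> ef eg fg; apply: freeg_additive_ext => -[h b].
by rewrite -[h]mulg1 -gactU ef eg fg.
Qed.

Definition eqext (m : B -> FC) : FB -> FC :=
  linext (fun p => gact (phi p.1) (m p.2)).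

HB.instance Definition _ m := GRing.Additive.on (eqext m).

Lemma eqextU m h b : eqext m << (h, b) >> = gact (phi h) (m b).
Proof. exact: linextU. Qed.

Lemma eqext1 m b : eqext m << (1%g, b) >> = m b.
Proof. by rewrite eqextU group_morph1 gact1. Qed.

Lemma eqext_equivariant m : equivariant (eqext m).
Proof.
move=> h; apply: (@freeg_additive_ext _ _ (eqext m \o gact h) (gact (phi h) \o eqext m)).
by case=> k b /=; rewrite gactU !eqextU gmulfM gactM.
Qed.

Definition coinv_map (f : FB -> FC) : {freeg B / int} -> {freeg C / int} :=
  linext (fun b => coinv (f << (1%g, b) >>)).

HB.instance Definition _ f := GRing.Additive.on (coinv_map f).

Lemma coinv_mapU f b : coinv_map f << b >> = coinv (f << (1%g, b) >>).
Proof. exact: linextU. Qed.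

Lemma coinv_mapE (f : {additive FB -> FC}) : equivariant f ->
  forall x, coinv_map f (coinv x) = coinv (f x).
Proof.
move=> ef; apply: (@freeg_additive_ext _ _ (coinv_map f \o @coinv _ _) (@coinv _ _ \o f)).
by case=> k b /=; rewrite coinvU coinv_mapU -[k in RHS]mulg1 -gactU ef coinv_gact.
Qed.

Lemma coinv_lift (y : {freeg B / int}) : coinv (push (pair (1%g : H)) y) = y.
Proof. by rewrite /coinv push_comp -[RHS]push_id; apply: eq_push. Qed.

End EquivariantMaps.

(** * Free resolutions and the comparison theorem *)

Section Solve.
Variables (A B : zmodType) (f : A -> B).

(** Choosing preimages with the default 0 lets comparison maps and homotopies be defined by plain
    recursion on the degree; that the equations are solvable is proved afterwards. *)
Definition solve (b : B) : A :=
  if pselect (exists a, f a = b) is left e then projT1 (cid e) else 0.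

Lemma solveP b : (exists a, f a = b) -> f (solve b) = b.
Proof. by rewrite /solve; case: pselect => // e _; case: cid. Qed.

End Solve.

Record resolution (G : groupType) := Resolution {
  rbase : nat -> choiceType;
  rd : forall n, {additive {freeg (G * rbase n.+1) / int} ->
                           {freeg (G * rbase n) / int}};
  raug : {additive {freeg (G * rbase 0) / int} -> int};
  rd_eq : forall n, equivariant idfun (rd n);
  raug_eq : forall g x, raug (gact g x) = raug x;
  rdd : forall n x, rd n (rd n.+1 x) = 0;
  raug_d : forall x, raug (rd 0 x) = 0;
  raug_surj : forall k, exists x, raug x = k;
  rexact0 : forall x, raug x = 0 -> exists y, rd 0 y = x;
  rexact : forall n x, rd n x = 0 -> exists y, rd n.+1 y = x
}.

Arguments rd {G} r n.
Arguments raug {G} r.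

Section CoinvariantComplex.
Variables (G : groupType) (R : resolution G).

Definition cd n : {freeg (rbase R n.+1) / int} -> {freeg (rbase R n) / int} :=
  coinv_map (rd R n).

HB.instance Definition _ n := GRing.Additive.on (@cd n).

Lemma cdE n x : @cd n (coinv x) = coinv (rd R n x).
Proof. exact/coinv_mapE/rd_eq. Qed.

Definition ccycle n : {freeg (rbase R n) / int} -> Prop :=
  match n with
  | 0 => fun=> True
  | n.+1 => fun x => cd x = 0
  end.

End CoinvariantComplex.

Arguments cd {G} R n.
Arguments ccycle {G} R n x.

Section GMaps.
Variables (H G : groupType) (phi : {multiplicative H -> G}).
Variables (R : resolution H) (S : resolution G).

Record gmap := Gmap {
  gm : forall n, {additive {freeg (H * rbase R n) / int} ->
                           {freeg (G * rbase S n) / int}};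
  gm_eq : forall n, equivariant phi (gm n);
  gm_d : forall n x, rd S n (gm n.+1 x) = gm n (rd R n x);
  gm_aug : forall x, raug S (gm 0 x) = raug R x
}.

Fixpoint gmap_base n : rbase R n -> {freeg (G * rbase S n) / int} :=
  match n with
  | 0 => fun b => solve (raug S) (raug R << (1%g, b) >>)
  | n.+1 => fun b => solve (rd S n) (eqext phi (@gmap_base n) (rd R n << (1%g, b) >>))
  end.

Lemma gmap_base_aug x : raug S (eqext phi (@gmap_base 0) x) = raug R x.
Proof.
move: x; apply: (@freeg_additive_ext _ _ (raug S \o eqext phi (@gmap_base 0))) => -[h b] /=.
rewrite eqextU raug_eq solveP; last exact: raug_surj.
by rewrite -[h in RHS]mulg1 -gactU raug_eq.
Qed.

Lemma gmap_base_d n x : rd S n (eqext phi (@gmap_base n.+1) x) =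
  eqext phi (@gmap_base n) (rd R n x).
Proof.
have step m :
    (forall b, exists y, rd S m y = eqext phi (@gmap_base m) (rd R m << (1%g, b) >>)) ->
    forall y, rd S m (eqext phi (@gmap_base m.+1) y) = eqext phi (@gmap_base m) (rd R m y).
  move=> ex; apply: (@equivariant_ext _ _ phi _ _ (rd S m \o eqext phi (@gmap_base m.+1))
    (eqext phi (@gmap_base m) \o rd R m)) => [h y|h y|b] /=.
  - by rewrite eqext_equivariant rd_eq.
  - by rewrite (rd_eq h) eqext_equivariant.
  - by rewrite eqext1; apply: solveP.
(* The equation one degree lower shows that the element to be lifted is a cycle, which exactness
   then lifts. *)
elim: n x => [|n IH]; apply: step => b.
  by apply: rexact0; rewrite gmap_base_aug raug_d.
by apply: rexact; rewrite IH rdd raddf0.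
Qed.

Lemma gmap_exists : inhabited gmap.
Proof.
split; exists (fun n => eqext phi (@gmap_base n)) => [n||].
- exact: eqext_equivariant.
- exact: gmap_base_d.
- exact: gmap_base_aug.
Qed.

Section Homotopy.
Variables f g : gmap.

(** The chain homotopy s, solved degree by degree from d s = f - g - s d. *)
Fixpoint homotopy_base n : rbase R n -> {freeg (G * rbase S n.+1) / int} :=
  match n with
  | 0 => fun b => solve (rd S 0) (gm f 0 << (1%g, b) >> - gm g 0 << (1%g, b) >>)
  | n.+1 => fun b => solve (rd S n.+1)
      (gm f n.+1 << (1%g, b) >> - gm g n.+1 << (1%g, b) >> -
       eqext phi (@homotopy_base n) (rd R n << (1%g, b) >>))
  end.

Lemma homotopy_base0 x :
  rd S 0 (eqext phi (@homotopy_base 0) x) = gm f 0 x - gm g 0 x.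
Proof.
move: x; apply: (@equivariant_ext _ _ phi _ _ (rd S 0 \o eqext phi (@homotopy_base 0))
  (gm f 0 \- gm g 0)) => [h x|h x|b] /=.
- by rewrite eqext_equivariant rd_eq.
- by rewrite !gm_eq raddfB.
rewrite eqext1; apply: solveP; apply: rexact0.
by rewrite raddfB /= !gm_aug subrr.
Qed.

Lemma homotopy_baseS n x :
  rd S n.+1 (eqext phi (@homotopy_base n.+1) x) =
  gm f n.+1 x - gm g n.+1 x - eqext phi (@homotopy_base n) (rd R n x).
Proof.
have step m :
    (forall y, rd S m (eqext phi (@homotopy_base m) (rd R m y)) =
       gm f m (rd R m y) - gm g m (rd R m y)) ->
    forall y, rd S m.+1 (eqext phi (@homotopy_base m.+1) y) =
      gm f m.+1 y - gm g m.+1 y - eqext phi (@homotopy_base m) (rd R m y).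
  move=> hm; apply: (@equivariant_ext _ _ phi _ _
    (rd S m.+1 \o eqext phi (@homotopy_base m.+1))
    ((gm f m.+1 \- gm g m.+1) \- (eqext phi (@homotopy_base m) \o rd R m)))
    => [h y|h y|b] /=.
  - by rewrite eqext_equivariant rd_eq.
  - by rewrite !gm_eq (rd_eq h) eqext_equivariant !raddfB.
  rewrite eqext1; apply: solveP; apply: rexact.
  by rewrite !raddfB /= hm !gm_d subrr.
elim: n x => [|n IH]; first by apply: step => y; rewrite homotopy_base0.
by apply: step => y; rewrite IH rdd raddf0 subr0.
Qed.

Lemma gm_homotopic n x : ccycle R n x ->
  exists y, cd S n y = coinv_map (gm f n) x - coinv_map (gm g n) x.
Proof.
rewrite -[x](coinv_lift H); set x1 := push _ x => xc.
exists (coinv (eqext phi (@homotopy_base n) x1)).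
rewrite !(coinv_mapE (@gm_eq _ n)) cdE; case: n x @x1 xc => [|n] x x1 xc.
  by rewrite homotopy_base0 raddfB.
(* The lift [x1] need not be a cycle: the term s d x1 vanishes only on coinvariants, where it
   depends on [cd] of x alone. *)
rewrite homotopy_baseS !raddfB /= -(coinv_mapE (@eqext_equivariant _ _ phi _ _ _)).
by move: xc; rewrite /= cdE => ->; rewrite raddf0 subr0.
Qed.

End Homotopy.

Lemma coinv_map_gm_d (f : gmap) n x :
  cd S n (coinv_map (gm f n.+1) x) = coinv_map (gm f n) (cd R n x).
Proof.
rewrite -[x](coinv_lift H); set x1 := push _ x.
by rewrite (coinv_mapE (@gm_eq _ _)) !cdE (coinv_mapE (@gm_eq _ _)) gm_d.
Qed.

End GMaps.

(** Composites such as [idfun \o idfun] carry a morphism structure other than that of [idfun]; this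
    transports equivariance along a pointwise equality. *)
Definition gmap_cast (H G : groupType) (phi psi : {multiplicative H -> G})
  (e : phi =1 psi) (R : resolution H) (S : resolution G) (f : gmap phi R S) : gmap psi R S.
Proof.
exists (gm f) => [n h x||]; first by rewrite gm_eq e.
- exact: gm_d.
- exact: gm_aug.
Defined.

Section GMapCategory.

Definition gmap_id (G : groupType) (R : resolution G) : gmap idfun R R :=
  @Gmap _ _ idfun R R (fun n => idfun) (fun _ _ _ => erefl) (fun _ _ => erefl)
    (fun _ => erefl).

Lemma coinv_map_id (G : groupType) (R : resolution G) n x :
  coinv_map (gm (gmap_id R) n) x = x.
Proof.
move: x; apply: (@freeg_additive_ext _ _ (coinv_map (gm (gmap_id R) n)) idfun) => b.
by rewrite /= coinv_mapU coinvU.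
Qed.

Variables (H K G : groupType) (phi : {multiplicative H -> K}).
Variables (psi : {multiplicative K -> G}).
Variables (R : resolution H) (S : resolution K) (T : resolution G).
Variables (f : gmap phi R S) (g : gmap psi S T).

Definition gmap_comp : gmap (psi \o phi) R T.
Proof.
exists (fun n => gm g n \o gm f n) => [n h x|n x|x] /=.
- by rewrite !gm_eq.
- by rewrite !gm_d.
- by rewrite !gm_aug.
Defined.

Lemma coinv_map_comp n x :
  coinv_map (gm gmap_comp n) x = coinv_map (gm g n) (coinv_map (gm f n) x).
Proof.
rewrite -[x](coinv_lift H); set x1 := push _ x.
by rewrite !(coinv_mapE (@gm_eq _ _ _ _ _ _ _)).
Qed.

End GMapCategory.

(** * The bar resolution *)

Section BarResolution.
Variable G : groupType.

Lemma tnth_bar_face n i (g : n.+1.-tuple G) (j : 'I_n) :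
  tnth (bar_face i g) j = face_fun i (nth 1%g g) j.
Proof. by apply: face_funE => k; rewrite (tnth_nth 1%g). Qed.

Lemma bar_face_cons n i h (g : n.+1.-tuple G) :
  bar_face i.+2 [tuple of h :: g] = [tuple of h :: bar_face i.+1 g].
Proof.
apply: eq_from_tnth => -[[|j] jn]; rewrite tnth_bar_face (tnth_nth 1%g) //=.
rewrite -[RHS](tnth_nth 1%g (bar_face i.+1 g) (Ordinal (jn : (j < n)%N))).
by rewrite tnth_bar_face /face_fun /= eqSS.
Qed.

Lemma behead_bar_face n i h (g : n.+1.-tuple G) :
  behead_tuple (bar_face i.+1 [tuple of h :: g]) = bar_face i g.
Proof.
apply: eq_from_tnth => j; rewrite tnth_behead !tnth_bar_face inordK; last first.
  by rewrite ltnS.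
by rewrite /face_fun /= eqSS.
Qed.

Definition join_tuple n (p : G * n.-tuple G) : n.+1.-tuple G := [tuple of p.1 :: p.2].
Definition split_tuple n (t : n.+1.-tuple G) : G * n.-tuple G := (thead t, behead_tuple t).

Lemma split_tupleK n : cancel (@split_tuple n) (@join_tuple n).
Proof. by move=> t; rewrite [RHS]tuple_eta; apply: val_inj. Qed.

(** With h[g_1|...|g_n] seen as the tuple (h, g_1, ..., g_n), the faces of the bar resolution are
    the bar faces other than the one forgetting h, so the simplicial identities carry over. *)
Definition bres_face n i (p : G * n.+1.-tuple G) : G * n.-tuple G :=
  split_tuple (bar_face i.+1 (join_tuple p)).

Lemma bres_faceE n i h (t : n.+1.-tuple G) :
  bres_face i (h, t) = (if i is 0 then (h * nth 1 t 0)%g else h, bar_face i t).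
Proof.
rewrite /bres_face /split_tuple behead_bar_face; congr (_, _).
by rewrite /thead tnth_bar_face /face_fun /=; case: i.
Qed.

Lemma bres_face_mul n i g h (t : n.+1.-tuple G) :
  bres_face i ((g * h)%g, t) =
  ((g * (bres_face i (h, t)).1)%g, (bres_face i (h, t)).2).
Proof. by rewrite !bres_faceE; case: i => [|i]; rewrite /= ?mulgA. Qed.

Lemma bres_face_face n i j (p : G * n.+2.-tuple G) : (j < i)%N ->
  bres_face j (bres_face i p) = bres_face i.-1 (bres_face j p).
Proof.
case: i => // i lt_ji.
by rewrite /bres_face !split_tupleK [in LHS]bar_face_face.
Qed.

Definition bres_d n : {freeg (G * n.+1.-tuple G) / int} ->
    {freeg (G * n.-tuple G) / int} :=
  linext (fun p => \sum_(i < n.+2) (-1) ^+ i *: << bres_face i p >>).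

HB.instance Definition _ n := GRing.Additive.on (@bres_d n).

Lemma bres_dU n p : @bres_d n << p >> = \sum_(i < n.+2) (-1) ^+ i *: << bres_face i p >>.
Proof. exact: linextU. Qed.

Lemma bres_d_eq n : equivariant idfun (@bres_d n).
Proof.
move=> g; apply: (@freeg_additive_ext _ _ (@bres_d n \o gact g) (gact g \o @bres_d n)).
case=> h t /=; rewrite gactU !bres_dU raddf_sum; apply: eq_bigr => i _.
by rewrite additive_scalez /= bres_face_mul -gactU -surjective_pairing.
Qed.

Lemma bres_dd n x : bres_d (@bres_d n.+1 x) = 0.
Proof.
move: x; apply: (@freeg_additive_ext _ _ (@bres_d n \o @bres_d n.+1) \0) => p /=.
rewrite bres_dU raddf_sum -[RHS](@simplicial_sum0 {freeg (G * n.-tuple G) / int} n.+2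
  (fun i j => << bres_face j (bres_face i p) >>)).
  by apply: eq_bigr => i _; rewrite additive_scalez /= bres_dU.
by move=> i j lt_ji; rewrite bres_face_face.
Qed.

Lemma deg_gact (B : choiceType) g (x : {freeg (G * B) / int}) : deg (gact g x) = deg x.
Proof.
move: x; apply: (@freeg_additive_ext _ _ (@deg (G * B)%type \o gact g) (@deg (G * B)%type)) => -[h b] /=.
by rewrite gactU !degU.
Qed.

Lemma degZ (K : choiceType) (k : int) (x : {freeg K / int}) : deg (k *: x) = k * deg x.
Proof. exact: (@additive_scalez _ int^o (@deg K)). Qed.

Lemma deg_bres_d x : deg (@bres_d 0 x) = 0.
Proof.
move: x; apply: (@freeg_additive_ext _ _ (@deg (G * 0.-tuple G)%type \o @bres_d 0) \0) => p /=.
by rewrite bres_dU !big_ord_recl big_ord0 /= !raddfD /= !degZ !degU raddf0 !mulr1 expr0 expr1 addr0 subrr.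
Qed.

(** The extra degeneracy h[g_1|...|g_n] to 1[h|g_1|...|g_n], additive but not equivariant, which
    contracts the complex. *)
Definition bres_s n : {freeg (G * n.-tuple G) / int} -> {freeg (G * n.+1.-tuple G) / int} :=
  push (fun p => (1%g, join_tuple p)).

HB.instance Definition _ n := GRing.Additive.on (@bres_s n).

Lemma bres_sU n p : @bres_s n << p >> = << (1%g, join_tuple p) >>.
Proof. exact: pushU. Qed.

Lemma bres_face_s0 n (p : G * n.-tuple G) : bres_face 0 (1%g, join_tuple p) = p.
Proof.
case: p => h t; rewrite bres_faceE /= mul1g; congr (_, _).
by apply: eq_from_tnth => j; rewrite tnth_bar_face (tnth_nth 1%g).
Qed.

Lemma bres_face_sS n i (p : G * n.+1.-tuple G) :
  bres_face i.+1 (1%g, join_tuple p) = (1%g, join_tuple (bres_face i p)).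
Proof.
rewrite split_tupleK /bres_face /split_tuple bar_face_cons; congr (_, _).
by apply: val_inj.
Qed.

Lemma bres_homotopy n x :
  bres_d (@bres_s n.+1 x) = x - bres_s (bres_d x).
Proof.
move: x; apply: (@freeg_additive_ext _ _ (@bres_d n.+1 \o @bres_s n.+1)
  (idfun \- (@bres_s n \o @bres_d n))) => -[h t] /=.
rewrite bres_sU !bres_dU big_ord_recl expr0 scale1r bres_face_s0.
congr (_ + _); rewrite raddf_sum -sumrN; apply: eq_bigr => i _.
by rewrite bres_face_sS exprS mulN1r scaleNr (additive_scalez (@bres_s n)) /= bres_sU.
Qed.

Definition bar_resolution : resolution G.
Proof.
exists (fun n => n.-tuple G) (fun n => @bres_d n) (@deg (G * 0.-tuple G)%type).
- exact: bres_d_eq.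
- exact: deg_gact.
- exact: bres_dd.
- exact: deg_bres_d.
- by move=> k; exists << k *g (1%g, [tuple]) >>; exact: degU.
- move=> x x0; exists (bres_s x).
  suff e : bres_d (bres_s x) = x - deg x *: << (1%g, [tuple] : 0.-tuple G) >>.
    by rewrite [LHS]e x0 scale0r subr0.
  move: x {x0}; apply: freeg_additive_ind => [|a b Ha Hb|[h t]].
  - by rewrite !raddf0 scale0r subr0.
  - by rewrite !raddfB /= Ha Hb scalerBl !opprD !opprK !addrA; congr (_ + _); rewrite addrAC.
  - rewrite bres_sU bres_dU !big_ord_recl big_ord0 degU scale1r addr0.
    rewrite bres_face_s0 expr1 scaleN1r scale1r; congr (_ - << _ >>).
    by rewrite bres_faceE /= !tuple0.
- move=> n x xd; exists (bres_s x).
  by rewrite [LHS]bres_homotopy xd raddf0 subr0.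
Defined.

Lemma cd_bar n : cd bar_resolution n =1 @bar_d G n.
Proof.
apply: (@freeg_additive_ext _ _ (cd bar_resolution n) (@bar_d G n)) => t.
rewrite [RHS]bar_dU scale1r [LHS]coinv_mapU [X in coinv X]bres_dU raddf_sum; apply: eq_bigr => i _.
by rewrite additive_scalez bres_faceE; congr (_ *: _); apply: coinvU.
Qed.

Lemma ccycle_bar n (c : chain G n) : ccycle bar_resolution n c <-> c \in bar_cycle G n.
Proof. by case: n c => [|n] c; rewrite // inE /= cd_bar; split=> [->|/eqP]. Qed.

End BarResolution.

Section BarFunctoriality.
Variables (H G : groupType) (phi : {multiplicative H -> G}).

Definition bres_map n : {freeg (H * n.-tuple H) / int} -> {freeg (G * n.-tuple G) / int} :=
  eqext phi (fun t => << (1%g, map_tuple phi t) >>).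

HB.instance Definition _ n := GRing.Additive.on (@bres_map n).

Lemma bres_mapU n p : @bres_map n << p >> = << (phi p.1, map_tuple phi p.2) >>.
Proof. by case: p => h t; rewrite /bres_map eqextU gactU mulg1. Qed.

Definition bar_gmap : gmap phi (bar_resolution H) (bar_resolution G).
Proof.
exists (fun n => @bres_map n : {additive {freeg (H * n.-tuple H) / int} ->
    {freeg (G * n.-tuple G) / int}}) => [n|n|].
- exact: eqext_equivariant.
- apply: (@freeg_additive_ext _ _ (@bres_d _ n \o @bres_map n.+1)
    (@bres_map n \o @bres_d _ n)) => -[h t] /=.
  rewrite bres_mapU !bres_dU raddf_sum; apply: eq_bigr => i _.
  rewrite additive_scalez /= bres_mapU !bres_faceE /= map_bar_face.
  congr (_ *: << (_, _) >>).
  by case: (nat_of_ord i) => //; rewrite gmulfM (nth_map 1%g) ?size_tuple.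
- apply: (@freeg_additive_ext _ _ (@deg (G * 0.-tuple G)%type \o @bres_map 0) (@deg (H * 0.-tuple H)%type)) => p.
  by rewrite /= bres_mapU !degU.
Defined.

Lemma coinv_bar_gmap n : coinv_map (gm bar_gmap n) =1 chain_map phi n.
Proof.
apply: (@freeg_additive_ext _ _ (coinv_map (gm bar_gmap n)) (chain_map phi n)) => t.
by rewrite [RHS]chain_mapU [LHS]coinv_mapU [X in coinv X]bres_mapU [LHS]coinvU.
Qed.

End BarFunctoriality.

Lemma inj_surj_bijective (A B : Type) (f : A -> B) :
  injective f -> (forall b, exists a, f a = b) -> bijective f.
Proof.
move=> f_inj f_surj; exists (fun b => projT1 (cid (f_surj b))) => [a|b].
  by apply: f_inj; case: cid.
by case: cid.
Qed.

(** * Homology from the coinvariants of an arbitrary resolution *)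

Section HomologyOfResolution.
Variables (G : groupType) (R : resolution G).
Variables (f : gmap idfun (bar_resolution G) R).

Let p n : {additive chain G n -> {freeg (rbase R n) / int}} := coinv_map (gm f n).

Lemma gmap_bar_d n (c : chain G n.+1) : cd R n (p n.+1 c) = p n (bar_d c).
Proof.
rewrite -cd_bar. exact (@coinv_map_gm_d _ _ _ _ _ f n c).
Qed.

Lemma gmap_bar_cycle n (c : cycles G n) : ccycle R n (p n (val c)).
Proof.
case: n c => [//|n] [c cP]; apply: etrans (gmap_bar_d c) _.
by move: cP; rewrite inE => /eqP ->; rewrite raddf0.
Qed.

(** For the converse take a comparison map g back: c - g f c is a boundary since g f is homotopic to
    the identity, and g f c = g (d y) = d (g y). *)
Lemma gmap_bar_boundary n (c : cycles G n) :
  c \in bar_boundary G n <-> exists y, cd R n y = p n (val c).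
Proof.
split=> [/asboolP[b bc]|[y yc]].
  by exists (p n.+1 b); rewrite gmap_bar_d bc.
have [g] := gmap_exists idfun R (bar_resolution G).
pose gf : gmap idfun (bar_resolution G) (bar_resolution G) :=
  @gmap_cast G G (idfun \o idfun) idfun (fun=> erefl) _ _ (gmap_comp f g).
have cC : ccycle (bar_resolution G) n (val c) by apply/ccycle_bar; case: (c).
have [e] := gm_homotopic (gmap_id _) gf cC.
rewrite coinv_map_id [coinv_map (gm gf n) _](coinv_map_comp f g) -[coinv_map (gm f n) _]yc.
rewrite -coinv_map_gm_d => eE; apply/asboolP; exists (e + coinv_map (gm g n.+1) y).
by rewrite -[LHS]cd_bar raddfD /= eE subrK.
Qed.

Lemma gmap_bar_surj n x : ccycle R n x ->
  exists (c : cycles G n) y, cd R n y = x - p n (val c).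
Proof.
move=> xC; have [g] := gmap_exists idfun R (bar_resolution G).
have cC : coinv_map (gm g n) x \in bar_cycle G n.
  apply/ccycle_bar; case: n x xC => //= n x xC.
  by rewrite coinv_map_gm_d xC raddf0.
pose fg : gmap idfun R R := @gmap_cast G G (idfun \o idfun) idfun (fun=> erefl) _ _ (gmap_comp g f).
exists (Cycle cC); have [y yE] := gm_homotopic (gmap_id _) fg xC.
by exists y; rewrite yE coinv_map_id [coinv_map (gm fg n) _](coinv_map_comp g f).
Qed.

(** The map [xi] lives on all chains, so in the applications it can be written with plain
    coordinates, some taken modulo 2 or 4. The formula for [th] on classes serves to compute the map
    induced by the inclusion of Hei. *)
Lemma homology_resolution n (X : zmodType) (xi : {additive {freeg (rbase R n) / int} -> X}) :
  (forall y, xi (cd R n y) = 0) ->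
  (forall c, exists2 x, ccycle R n x & xi x = c) ->
  (forall x, ccycle R n x -> xi x = 0 -> exists y, cd R n y = x) ->
  exists2 th : {additive homology G n -> X}, bijective th &
    forall c : cycles G n,
      th (\pi_(Quotient.quot (bar_boundary G n)) c)%qT = xi (p n (val c)).
Proof.
move=> xi_d xi_surj xi_inj.
pose th (h : homology G n) : X := xi (p n (val (repr h))).
have thE (c : cycles G n) :
    th (\pi_(Quotient.quot (bar_boundary G n)) c)%qT = xi (p n (val c)).
  apply/eqP; rewrite -subr_eq0 -!raddfB /=.
  have: repr (\pi_(Quotient.quot (bar_boundary G n)) c)%qT - c \in bar_boundary G n.
    by rewrite Quotient.idealrBE reprK.
  by case/gmap_bar_boundary => y /= <-; rewrite xi_d.
have thB : zmod_morphism th.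
  by elim/quotW=> x; elim/quotW=> y; rewrite -[_ - _]raddfB !thE /= !raddfB.
pose tha : GRing.isZmodMorphism (homology G n) X th :=
  GRing.isZmodMorphism.Build (homology G n) X th thB.
pose ThA : {additive homology G n -> X} := HB.pack th tha.
exists ThA => //; apply: inj_surj_bijective => [|c].
  have inj0 h : th h = 0 -> h = 0.
    elim/quotW: h => x; rewrite thE => /(xi_inj _ (gmap_bar_cycle x)) e.
    rewrite -[RHS](raddf0 (\pi_(Quotient.quot (bar_boundary G n)))%qT).
    by apply/eqP; rewrite -Quotient.idealrBE subr0; apply/gmap_bar_boundary.
  move=> a b /= /eqP; rewrite -subr_eq0 -[th a - th b]thB => /eqP /inj0 /eqP.
  by rewrite subr_eq0 => /eqP.
have [x xC xc] := xi_surj c; have [c0 [y yE]] := gmap_bar_surj xC.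
exists (\pi_(Quotient.quot (bar_boundary G n)) c0)%qT; rewrite /= thE.
by apply/eqP; rewrite -xc eq_sym -subr_eq0 -raddfB /= -yE xi_d.
Qed.

End HomologyOfResolution.

(** * Resolutions given by matrices over the group ring *)

Section GroupRing.
Variable G : groupType.
Notation ZG := {freeg G / int}.

(** Right multiplication commutes with the left action, so the matrices of equivariant maps act
    through it, and composing maps multiplies entries in reading order. *)
Definition rmul (x : G) : ZG -> ZG := push (fun g => (g * x)%g).

HB.instance Definition _ x := GRing.Additive.on (rmul x).

Lemma rmulU x g : rmul x << g >> = << (g * x)%g >>.
Proof. exact: pushU. Qed.

Lemma rmulM x y a : rmul y (rmul x a) = rmul (x * y) a.
Proof. by rewrite /rmul push_comp; apply: eq_push => g /=; rewrite mulgA. Qed.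

Lemma rmul1 a : rmul 1 a = a.
Proof. by rewrite -[RHS]push_id; apply: eq_push => g; rewrite mulg1. Qed.

Definition lact (x : G) : ZG -> ZG := push (fun g => (x * g)%g).

HB.instance Definition _ x := GRing.Additive.on (lact x).

Lemma lactU x g : lact x << g >> = << (x * g)%g >>.
Proof. exact: pushU. Qed.

Lemma lact_rmul x y a : lact x (rmul y a) = rmul y (lact x a).
Proof. by rewrite /lact /rmul !push_comp; apply: eq_push => g /=; rewrite mulgA. Qed.

Section Coordinates.
Variable r : nat.
Notation F := {freeg (G * 'I_r) / int}.

Definition inj (i : nat) : ZG -> F :=
  linext (fun g => if insub i is Some j then << (g, j) >> else 0 : F).

HB.instance Definition _ i := GRing.Additive.on (inj i).

Lemma injU i g : inj i << g >> = if insub i is Some j then << (g, j) >> else 0.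
Proof. exact: linextU. Qed.

Lemma inj_ord (j : 'I_r) g : inj j << g >> = << (g, j) >>.
Proof. by rewrite injU valK. Qed.

Lemma inj_out i a : (r <= i)%N -> inj i a = 0.
Proof.
move=> ri; move: a; apply: (@freeg_additive_ext _ _ (inj i) \0) => g.
by rewrite [LHS]injU insubF // ltnNge ri.
Qed.

Definition comp (i : nat) : F -> ZG :=
  linext (fun p : G * 'I_r => if i == p.2 :> nat then << p.1 >> else 0 : ZG).

HB.instance Definition _ i := GRing.Additive.on (comp i).

Lemma compU i g (j : 'I_r) : comp i << (g, j) >> = if i == j then << g >> else 0.
Proof. exact: linextU. Qed.

Lemma comp_out i x : (r <= i)%N -> comp i x = 0.
Proof.
move=> ri; move: x; apply: (@freeg_additive_ext _ _ (comp i) \0) => -[g j].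
by rewrite [LHS]compU gtn_eqF // (leq_trans (ltn_ord j)).
Qed.

Lemma comp_inj i j a : comp i (inj j a) = if (i == j) && (j < r)%N then a else 0.
Proof.
case: (ltnP j r) => [jr|rj]; last by rewrite inj_out // raddf0 andbF.
rewrite andbT; case: eqP => [->|/eqP ij].
  move: a; apply: (@freeg_additive_ext _ _ (comp j \o inj j) idfun) => g /=.
  by rewrite (inj_ord (Ordinal jr)) compU eqxx.
move: a; apply: (@freeg_additive_ext _ _ (comp i \o inj j) \0) => g /=.
by rewrite (inj_ord (Ordinal jr)) compU /= (negPf ij).
Qed.

Lemma sum_inj_comp x : \sum_(j < r) inj j (comp j x) = x.
Proof.
move: x; apply: freeg_additive_ind => [|a b Ha Hb|[g j]].
- by rewrite big1 // => i _; rewrite !raddf0.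
- by rewrite -[in RHS]Ha -[in RHS]Hb -sumrB; apply: eq_bigr => i _; rewrite !raddfB.
- rewrite (bigD1 j) //= compU eqxx inj_ord big1 ?addr0 // => i ij.
  by rewrite compU (negPf ij : (i == j :> nat) = false) raddf0.
Qed.

Lemma comp_eq0 x : (forall i, (i < r)%N -> comp i x = 0) -> x = 0.
Proof.
by move=> x0; rewrite -[x]sum_inj_comp big1 // => i _; rewrite x0 // raddf0.
Qed.

Lemma gact_inj g i a : gact g (inj i a) = inj i (lact g a).
Proof.
move: a; apply: (@freeg_additive_ext _ _ (gact g \o inj i) (inj i \o lact g)) => h /=.
rewrite lactU !injU; case: insub => [j|]; last by rewrite raddf0.
by rewrite gactU.
Qed.

End Coordinates.
End GroupRing.

(** Elements of the group ring of a presented group are represented by lists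
    [\sum_k k w], vectors by lists of pairs (group ring element, coordinate);
    a coordinate out of range stands for [0].                                 *)
Section MatrixComplex.
Variables (X : choiceType) (rels : seq (word X * word X)).
Let G : groupType := presented rels.
Notation ZG := {freeg G / int}.
Notation zl := (seq (int * word X)).

Definition wpi (w : word X) : G := (\pi_(presented rels) w)%qT.

Lemma wpi_cat v w : wpi (v ++ w) = (wpi v * wpi w)%g.
Proof. by rewrite /wpi -presented_mulE. Qed.

Lemma wpi_nil : wpi [::] = 1%g.
Proof. by []. Qed.

Definition rl (a : zl) : ZG -> ZG :=
  linext (fun g => \sum_(p <- a) p.1 *: (<< (g * wpi p.2)%g >> : ZG)).

HB.instance Definition _ a := GRing.Additive.on (rl a).

Lemma rlE a x : rl a x = \sum_(p <- a) p.1 *: rmul (wpi p.2) x.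
Proof.
move: x; apply: freeg_additive_ind => [|x y Hx Hy|g].
- by rewrite raddf0 big1 // => p _; rewrite raddf0 scaler0.
- by rewrite raddfB /= Hx Hy -sumrB; apply: eq_bigr => p _; rewrite raddfB scalerBr.
- by rewrite /rl linextU; apply: eq_bigr => p _; rewrite rmulU.
Qed.

Definition lmulz (a b : zl) : zl := [seq (p.1 * q.1, p.2 ++ q.2) | p <- a, q <- b].

Lemma rl_lmulz a b x : rl (lmulz a b) x = rl b (rl a x).
Proof.
rewrite !rlE /lmulz big_allpairs_dep /= exchange_big /=; apply: eq_bigr => q _.
rewrite raddf_sum scaler_sumr; apply: eq_bigr => p _.
by rewrite additive_scalez /= rmulM wpi_cat scalerA mulrC.
Qed.

Lemma lact_rl g a x : lact g (rl a x) = rl a (lact g x).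
Proof.
rewrite !rlE raddf_sum; apply: eq_bigr => p _.
by rewrite additive_scalez /= lact_rmul.
Qed.

Notation vl := (seq (zl * nat)).

Definition vec r (l : vl) (x : ZG) : {freeg (G * 'I_r) / int} :=
  \sum_(e <- l) inj r e.2 (rl e.1 x).

Lemma vec_is_zmod_morphism r l : zmod_morphism (vec r l).
Proof. by move=> x y; rewrite -sumrB; apply: eq_bigr => e _; rewrite !raddfB. Qed.

HB.instance Definition _ r l :=
  GRing.isZmodMorphism.Build ZG {freeg (G * 'I_r) / int} (vec r l)
    (vec_is_zmod_morphism r l).

Lemma vec_cat r l m x : vec r (l ++ m) x = vec r l x + vec r m x.
Proof. exact: big_cat. Qed.

Lemma gact_vec r l g x : gact g (vec r l x) = vec r l (lact g x).
Proof. by rewrite raddf_sum; apply: eq_bigr => e _; rewrite /= gact_inj lact_rl. Qed.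

Lemma vecU r l g : vec r l << g >> = gact g (vec r l << 1%g >>).
Proof. by rewrite gact_vec lactU mulg1. Qed.

Lemma comp_vec r l i x : (i < r)%N ->
  comp i (vec r l x) = \sum_(e <- l | e.2 == i) rl e.1 x.
Proof.
move=> ir; rewrite raddf_sum [RHS]big_mkcond; apply: eq_bigr => e _ /=.
by rewrite comp_inj eq_sym; case: eqP => //= ->; rewrite ir.
Qed.

Definition lscale (a : zl) (l : vl) : vl := [seq (lmulz a e.1, e.2) | e <- l].

Lemma vec_lscale r a l x : vec r (lscale a l) x = vec r l (rl a x).
Proof. by rewrite /vec big_map; apply: eq_bigr => e _; rewrite rl_lmulz. Qed.

Section Check.
Variables (S : choiceType) (nfs : word X -> S) (nf : S -> G).
Hypothesis nfP : forall w, nf (nfs w) = wpi w.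

Definition vterms (l : vl) : seq (int * (S * nat)) :=
  [seq (p.1, (nfs p.2, e.2)) | e <- l, p <- e.1].

(** A zero test by computation: terms with the same normal form and coordinate are collected, and
    each total must vanish. It is sound because [nfP] makes words with equal normal forms equal in
    the group. *)
Definition vec0 r (l : vl) : bool :=
  let s := vterms l in
  all (fun t => (t.2.2 < r)%N ==>
    (foldr (fun q acc => if q.2 == t.2 then (q.1 + acc)%R else acc) 0 s == 0)) s.

Lemma vec0P r l x : vec0 r l -> vec r l x = 0.
Proof.
(* By equivariance x = 1 is enough, where the vector is the image of a formal sum indexed by normal
   forms. *)
move=> /allP l0; suff l1 : vec r l << 1%g >> = 0.
  move: x; apply: (@freeg_additive_ext _ _ (vec r l) \0) => g.
  by rewrite [LHS]vecU l1 raddf0.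
pose F (k : S * nat) : {freeg (G * 'I_r) / int} := inj r k.2 << nf k.1 >>.
have sE : vec r l << 1%g >> = \sum_(t <- vterms l) t.1 *: F t.2.
  rewrite /vterms big_allpairs_dep; apply: eq_bigr => e _.
  rewrite rlE raddf_sum; apply: eq_bigr => p _.
  by rewrite additive_scalez /= rmulU mul1g /F /= nfP.
have fE k : foldr (fun q acc => if q.2 == k then (q.1 + acc)%R else acc) 0 (vterms l) =
    coeff k (\sum_(t <- vterms l) t.1 *: (<< t.2 >> : {freeg (S * nat)%type / int})).
  elim: (vterms l) => [|q s IH]; first by rewrite big_nil raddf0.
  rewrite /= IH big_cons raddfD /= coeffZ coeffU mul1r.
  by case: eqP; rewrite ?mulr1 ?mulr0 ?add0r.
pose Fr (k : S * nat) : {freeg (G * 'I_r) / int} := if (k.2 < r)%N then F k else 0.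
have FrE k : Fr k = F k.
  by rewrite /Fr; case: ltnP => // rk; rewrite /F inj_out.
pose T := \sum_(t <- vterms l | (t.2.2 < r)%N) t.1 *: (<< t.2 >> : {freeg (S * nat)%type / int}).
have -> : vec r l << 1%g >> = linext Fr T.
  rewrite sE raddf_sum [RHS]big_mkcond; apply: eq_bigr => t _ /=.
  rewrite -FrE /Fr; case: ifP => tr; last by rewrite scaler0.
  by rewrite additive_scalez /= linextU tr.
suff -> : T = 0 by rewrite raddf0.
apply/eqP/freeg_eqP => k; rewrite coeff0.
have [kr|rk] := ltnP k.2 r; last first.
  rewrite raddf_sum big1_seq //= => t /andP[tr _].
  rewrite coeffZ coeffU mul1r; case: eqP => [tk|]; last by rewrite mulr0.
  by move: tr; rewrite tk ltnNge rk.
have -> : coeff k T = coeff k (\sum_(t <- vterms l) t.1 *: (<< t.2 >> : {freeg (S * nat)%type / int})).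
  rewrite !raddf_sum big_mkcond; apply: eq_bigr => t _ /=.
  case: ifP => // tr; rewrite coeffZ coeffU mul1r; case: eqP; rewrite ?mulr0 // => tk.
  by rewrite tk kr in tr.
rewrite -fE; have [|kT] := boolP (has (fun t => t.2 == k) (vterms l)).
  by case/hasP=> t tT /eqP tk; move: (l0 t tT); rewrite tk kr => /eqP.
by elim: (vterms l) kT => //= q s IH; rewrite negb_or => /andP[/negPf-> /IH].
Qed.

End Check.

Lemma vec_eq (S : choiceType) (nfs : word X -> S) (nf : S -> G) r l m x :
  (forall w, nf (nfs w) = wpi w) ->
  vec0 nfs r (l ++ lscale [:: (-1, [::])] m) -> vec r l x = vec r m x.
Proof.
move=> nfP lm0; have := vec0P nfP x lm0; rewrite vec_cat vec_lscale rlE big_seq1 scaleN1r rmul1.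
by rewrite raddfN => /eqP; rewrite addr_eq0 opprK => /eqP.
Qed.

Lemma rl_eq (S : choiceType) (nfs : word X -> S) (nf : S -> G) a b x :
  (forall w, nf (nfs w) = wpi w) ->
  vec0 nfs 1 ([:: (a, 0%N)] ++ lscale [:: (-1, [::])] [:: (b, 0%N)]) -> rl a x = rl b x.
Proof.
move=> nfP ab; have := congr1 (@comp _ _ 0) (vec_eq x nfP ab).
by rewrite !comp_vec // !big_cons !big_nil /= !addr0.
Qed.

Variables (r : nat -> nat) (D : nat -> nat -> vl).
Hypothesis D_out : forall n i, (r n.+1 <= i)%N -> D n i = [::].

Definition md n : {freeg (G * 'I_(r n.+1)) / int} -> {freeg (G * 'I_(r n)) / int} :=
  eqext idfun (fun j : 'I_(r n.+1) => vec (r n) (D n j) << 1%g >>).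

HB.instance Definition _ n := GRing.Additive.on (@md n).

Lemma md_inj n i x : md (inj (r n.+1) i x) = vec (r n) (D n i) x.
Proof.
have [ri|ir] := leqP (r n.+1) i.
  by rewrite inj_out // raddf0 D_out // /vec big_nil.
move: x; apply: (@freeg_additive_ext _ _ (@md n \o inj (r n.+1) i) (vec (r n) (D n i))) => g /=.
by rewrite (inj_ord (Ordinal ir)) /md eqextU [RHS]vecU.
Qed.

Lemma md_eq n : equivariant idfun (@md n).
Proof. exact: eqext_equivariant. Qed.

Lemma mdE n x : md x = \sum_(j < r n.+1) vec (r n) (D n j) (comp j x).
Proof.
by rewrite -[in LHS](sum_inj_comp x) raddf_sum; apply: eq_bigr => j _; rewrite /= md_inj.
Qed.

Lemma comp_md n i (x : {freeg (G * 'I_(r n.+1)) / int}) : (i < r n)%N ->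
  comp i (md x) = \sum_(j < r n.+1) \sum_(e <- D n j | e.2 == i) rl e.1 (comp j x).
Proof. by move=> ir; rewrite mdE raddf_sum; apply: eq_bigr => j _; apply: comp_vec. Qed.

Definition ldl n (l : vl) : vl := [seq (lmulz e.1 f.1, f.2) | e <- l, f <- D n e.2].

Lemma md_vec n l x : md (vec (r n.+1) l x) = vec (r n) (ldl n l) x.
Proof.
rewrite raddf_sum /ldl /vec big_allpairs_dep; apply: eq_bigr => e _.
by rewrite /= md_inj; apply: eq_bigr => f _; rewrite rl_lmulz.
Qed.

(** Exactness in degrees 0 and 1 amounts to the presentation: the Fox derivative
    of a word is well defined up to boundaries of relations, and splits [md 0]. *)
Section FoxCalculus.
Variables (der : X -> vl) (gen : nat -> X) (i0 : 'I_(r 0)).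
Hypothesis i0_all : forall j : 'I_(r 0), j = i0.

Fixpoint fox (w : word X) : vl :=
  if w is (x, b) :: w' then
    (if b then der x else lscale [:: (-1, [:: (x, false)])] (der x)) ++
    lscale [:: (1, [:: (x, b)])] (fox w')
  else [::].

Let foxv w := vec (r 1) (fox w) << 1%g >>.

Lemma rl1 w x : rl [:: (1, w)] x = rmul (wpi w) x.
Proof. by rewrite rlE big_seq1 scale1r. Qed.

Lemma fox_cons x b w : foxv ((x, b) :: w) =
  (if b then vec (r 1) (der x) << 1%g >>
   else - gact (wpi [:: (x, false)]) (vec (r 1) (der x) << 1%g >>)) +
  gact (wpi [:: (x, b)]) (foxv w).
Proof.
rewrite /foxv /= vec_cat; congr (_ + _); last first.
  by rewrite vec_lscale rl1 rmulU mul1g vecU.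
case: b => //; rewrite vec_lscale rlE big_seq1 scaleN1r raddfN rmulU mul1g.
by rewrite [in LHS]/= vecU.
Qed.

Lemma fox_cat v w : foxv (v ++ w) = foxv v + gact (wpi v) (foxv w).
Proof.
elim: v => [|[x b] v IH]; first by rewrite wpi_nil gact1 /foxv /vec big_nil add0r.
rewrite cat_cons !fox_cons IH raddfD /= addrA gactM -wpi_cat.
by [].
Qed.

Hypothesis der_d : forall x,
  md (vec (r 1) (der x) << 1%g >>) = << (wpi (wgen x), i0) >> - << (1%g, i0) >>.

Lemma md_fox w : md (foxv w) = << (wpi w, i0) >> - << (1%g, i0) >>.
Proof.
elim: w => [|[x b] w IH]; first by rewrite /foxv /vec big_nil raddf0 subrr.
rewrite fox_cons raddfD /= (md_eq (wpi [:: (x, b)])) IH raddfB /= !gactU mulg1.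
rewrite -wpi_cat /= addrC -addrA; congr (_ + _).
case: b; first by rewrite der_d addKr.
rewrite raddfN /= (md_eq (wpi [:: (x, false)])) der_d raddfB /= !gactU mulg1.
have -> : (wpi [:: (x, false)] * wpi (wgen x))%g = 1%g.
  by rewrite -wpi_cat -wpi_nil; apply/presented_eqP/(word_eq_cancel _ x false).
by rewrite opprB addKr.
Qed.

Hypothesis rels_d : forall q, q \in rels -> exists y, md y = foxv q.1 - foxv q.2.

(** A cancelling pair has derivative 0, and in a product the derivative of the second factor is
    twisted only by the class of the first, so that only the relations contribute boundaries. *)
Lemma fox_eq v w : word_eq rels v w -> exists y, @md 1 y = foxv v - foxv w.
Proof.
have f0 : foxv [::] = 0 by rewrite /foxv /vec big_nil.
elim=> {v w} [w|v w _ [y yE]|v w1 w2 _ [y yE] _ [y2 yE2]|v1 v2 w1 w2 e1 [y1 yE1] _ [y2 yE2]|x b|].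
- by exists 0; rewrite raddf0 subrr.
- by exists (- y); rewrite raddfN /= yE opprB.
- by exists (y + y2); rewrite raddfD /= yE yE2 addrA subrK.
- exists (y1 + gact (wpi v1) y2); rewrite raddfD /= (md_eq (wpi v1)) yE1 yE2.
  have -> : foxv (w1 ++ w2) = foxv w1 + gact (wpi v1) (foxv w2).
    by rewrite fox_cat; congr (_ + gact _ _); apply/esym/presented_eqP.
  by rewrite fox_cat raddfB /= opprD addrACA.
- exists 0; rewrite raddf0 !fox_cons f0 raddf0 subr0 addr0.
  have e : (wpi [:: (x, b)] * wpi [:: (x, ~~ b)])%g = 1%g.
    by rewrite -wpi_cat -wpi_nil; apply/presented_eqP/(word_eq_cancel _ x b).
  case: b e => e /=; first by rewrite raddfN /= gactM e gact1 subrr.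
  by rewrite addNr.
- by move=> q /rels_d.
Qed.

Hypothesis gen_d : forall j : 'I_(r 1),
  vec (r 1) (der (gen j)) << 1%g >> = << (1%g, j) >>.

Definition foxh : {freeg (G * 'I_(r 0)) / int} -> {freeg (G * 'I_(r 1)) / int} :=
  linext (fun p : G * 'I_(r 0) => foxv (repr p.1)).

HB.instance Definition _ := GRing.Additive.on foxh.

Lemma foxhU g j : foxh << (g, j) >> = foxv (repr g).
Proof. exact: linextU. Qed.

Lemma fox_aug x : deg (@md 0 x) = 0.
Proof.
move: x; apply: (@freeg_additive_ext _ _ (@deg (G * 'I_(r 0))%type \o @md 0) \0) => -[g j] /=.
rewrite -[g]mulg1 -gactU (md_eq g) -gen_d der_d raddfB /= !gactU raddfB /= !degU.
by rewrite subrr.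
Qed.

Lemma fox_exact0 x : deg x = 0 -> exists y, @md 0 y = x.
Proof.
move=> x0; exists (foxh x).
suff e : md (foxh x) = x - deg x *: << (1%g, i0) >>.
  by rewrite e x0 scale0r subr0.
move: x {x0}; apply: freeg_additive_ind => [|a b Ha Hb|[g j]].
- by rewrite !raddf0 scale0r subr0.
- by rewrite !raddfB /= Ha Hb scalerBl !opprD !opprK !addrA; congr (_ + _); rewrite addrAC.
- rewrite foxhU md_fox degU scale1r (i0_all j) /wpi; congr (<< (_, _) >> - _).
  exact: reprK.
Qed.

(** [foxh] contracts the complex up to boundaries: on g times a generator x, its defect is the
    difference of the Fox derivatives of two words for g x, a boundary by [fox_eq]. *)
Lemma fox_exact1 x : @md 0 x = 0 -> exists y, @md 1 y = x.
Proof.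
move=> x0; suff [y yE] : exists y, @md 1 y = foxh (md x) - x.
  by exists (- y); rewrite raddfN /= yE x0 raddf0 sub0r opprK.
move: x {x0}; apply: freeg_additive_ind => [|a b [y yE] [y' yE']|[g j]].
- by exists 0; rewrite !raddf0 addr0.
- exists (y - y'); rewrite raddfB /= yE yE' !raddfB /= ?opprD ?opprK !addrA.
  by congr (_ + _); rewrite addrAC.
have [y yE] : exists y, @md 1 y = foxv (repr (g * wpi (wgen (gen j)))%g) -
    foxv (repr g ++ wgen (gen j)).
  apply: fox_eq; apply/presented_eqP; rewrite reprK -[RHS]/(wpi _) wpi_cat.
  by rewrite /wpi reprK.
have foxg : foxv (wgen (gen j)) = << (1%g, j) >>.
  by rewrite /wgen fox_cons gen_d /foxv /vec big_nil raddf0 addr0.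
exists y; rewrite yE fox_cat foxg /wpi reprK gactU mulg1 opprD addrA; congr (_ - _).
have -> : md << (g, j) >> = << ((g * wpi (wgen (gen j)))%g, i0) >> - << (g, i0) >>.
  by rewrite -[g]mulg1 -gactU (md_eq g) -gen_d der_d raddfB /= !gactU !mulg1.
by rewrite raddfB /= !foxhU.
Qed.

End FoxCalculus.

End MatrixComplex.

Arguments rl {X} rels a x.
Arguments vec {X} rels r l x.
Arguments md {X} rels r D n x.

(** * The group Hei4 and its group ring *)

Section PresentedRelations.
Variables (X : choiceType) (rels : seq (word X * word X)).
Local Open Scope group_scope.

Lemma presented_rel q : q \in rels -> wpi rels q.1 = wpi rels q.2.
Proof. by move=> /word_eq_rel /presented_eqP. Qed.

Lemma wpi_inv x : wpi rels [:: (x, false)] = (pgen rels x)^-1.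
Proof.
apply: (mulgI (pgen rels x)); rewrite mulgV -[pgen rels x]/(wpi rels [:: (x, true)]).
by rewrite -wpi_cat -(wpi_nil rels); apply/presented_eqP/(word_eq_cancel _ x true).
Qed.

Lemma wpi_letter x b :
  wpi rels [:: (x, b)] = if b then pgen rels x else (pgen rels x)^-1.
Proof. by case: b => //; apply: wpi_inv. Qed.

Lemma wpi_cons l w : wpi rels (l :: w) = wpi rels [:: l] * wpi rels w.
Proof. by rewrite -wpi_cat. Qed.

Lemma wpi_wcomm x y : wpi rels (wcomm (wgen x) (wgen y)) =
  pgen rels x * pgen rels y * (pgen rels x)^-1 * (pgen rels y)^-1.
Proof. by rewrite /wcomm !wpi_cat !wpi_inv !mulgA. Qed.

End PresentedRelations.

Section Hei4NormalForm.

Definition hei4_state : Type := (int * int * int * (bool * bool))%type.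

Definition quarter (k : bool * bool) : bool * bool := (k.1 (+) k.2, ~~ k.2).

Definition quarter_inv (k : bool * bool) : bool * bool := (k.1 (+) ~~ k.2, ~~ k.2).

(** Right multiplication of u^i v^j z^c by t^k u t^-k, which is u, v, u^-1 or v^-1; moving u to the
    left of v^j costs z^-j. *)
Definition hei4_step (k : bool * bool) (p : int * int * int) : int * int * int :=
  let: (i, j, c) := p in
  match k with
  | (false, false) => (i + 1, j, c - j)
  | (false, true) => (i, j + 1, c)
  | (true, false) => (i - 1, j, c + j)
  | (true, true) => (i, j - 1, c)
  end.

(** The right translation action of [Hei4] on its normal forms
    [u^i v^j z^c t^k], with [k] written in binary.                            *)
Definition hei4_ract (s : hei4_state) (l : hei4_gen * bool) : hei4_state :=
  let: (p, k) := s in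
  match l with
  | (Gu, true) => (hei4_step k p, k)
  | (Gu, false) => (hei4_step (quarter (quarter k)) p, k)
  | (Gv, true) => (hei4_step (quarter k) p, k)
  | (Gv, false) => (hei4_step (quarter_inv k) p, k)
  | (Gz, b) => let: (i, j, c) := p in ((i, j, if b then c + 1 else c - 1), k)
  | (Gt, b) => (p, if b then quarter k else quarter_inv k)
  end.

Definition hei4_st (w : word hei4_gen) : hei4_state :=
  foldl hei4_ract (0, 0, 0, (false, false)) w.

(** Compatibility with the relations makes the normal form a function on the group; the residue,
    parity and height functions used for kernels are read off it. *)
Lemma hei4_ract_eq v w : word_eq hei4_rels v w ->
  forall s, foldl hei4_ract s v = foldl hei4_ract s w.
Proof.
elim=> {v w} //=.
- by move=> v w1 w2 _ IH1 _ IH2 s; rewrite IH1.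
- by move=> v1 v2 w1 w2 _ IH1 _ IH2 s; rewrite !foldl_cat IH1 IH2.
- move=> x b [[[i j] c] k].
  by case: x; case: b; case: k => [[] []] /=; do ![congr (_, _)]; ring.
move=> q; rewrite !inE.
by do ![case/predU1P=> [->|]] => [s|s|s|s|s|s|/eqP-> s];
  case: s => [[[i j] c] [[] []]] /=; do ![congr (_, _)]; ring.
Qed.

Local Open Scope group_scope.
Notation G := Hei4.
Let u : G := pgen hei4_rels Gu.
Let v : G := pgen hei4_rels Gv.
Let z : G := pgen hei4_rels Gz.
Let t : G := pgen hei4_rels Gt.

Lemma hei4_rel i : (i < 7)%N ->
  wpi hei4_rels (nth ([::], [::]) hei4_rels i).1 =
  wpi hei4_rels (nth ([::], [::]) hei4_rels i).2.
Proof. by move=> i7; apply/presented_rel/mem_nth. Qed.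

Lemma hei4_uz : commute u z.
Proof.
have := @hei4_rel 0 isT; rewrite /= wpi_wcomm => /divg1_eq e.
by rewrite /commute -[LHS](mulgVK u) e.
Qed.

Lemma hei4_vz : commute v z.
Proof.
have := @hei4_rel 1 isT; rewrite /= wpi_wcomm => /divg1_eq e.
by rewrite /commute -[LHS](mulgVK v) e.
Qed.

Lemma hei4_tz : commute t z.
Proof.
have := @hei4_rel 2 isT; rewrite /= wpi_wcomm => /divg1_eq e.
by rewrite /commute -[LHS](mulgVK t) e.
Qed.

Lemma hei4_t4 : t * (t * (t * t)) = 1.
Proof. by have := @hei4_rel 3 isT; rewrite /= -/(wgen Gt) !(wpi_cons _ (_, _) (_ :: _)). Qed.

Lemma hei4_vu : v * u = u * (v * z^-1).
Proof.
have zC : z^-1 * (u * v) = u * (v * z^-1).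
  rewrite [RHS]mulgA; apply/commute_sym/commuteV/commute_sym/commuteM.
    exact/commute_sym/hei4_uz.
  exact/commute_sym/hei4_vz.
rewrite -zC.
have := @hei4_rel 4 isT; rewrite /= wpi_wcomm -/u -/v -[wpi _ _]/z => <-.
by rewrite !invgM !invgK !mulgA !mulgVK.
Qed.

Lemma hei4_tu : t * u = v * t.
Proof.
have e : wpi hei4_rels [:: (Gt, true); (Gu, true); (Gt, false)] = v := @hei4_rel 5 isT.
by rewrite -e !(wpi_cons _ _ (_ :: _)) !wpi_letter !mulgA mulgVK.
Qed.

Lemma hei4_tv : t * v = u^-1 * t.
Proof.
have e : wpi hei4_rels [:: (Gt, true); (Gv, true); (Gt, false)] =
  wpi hei4_rels [:: (Gu, false)] := @hei4_rel 6 isT.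
by rewrite -[u^-1](wpi_letter _ _ false) -e !(wpi_cons _ _ (_ :: _)) !wpi_letter !mulgA mulgVK.
Qed.

Definition hei4_nf (s : hei4_state) : G :=
  let: (i, j, c, k) := s in
  zexpg u i * (zexpg v j * zexpg z c) *
    match k with
    | (false, false) => 1
    | (false, true) => t
    | (true, false) => t * t
    | (true, true) => t * (t * t)
    end.

Lemma hei4_zexpg_vu j : zexpg v j * u = u * (zexpg v j * zexpg z (- j)).
Proof.
have zC a : commute v (zexpg z a) by apply/zexpg_comm/hei4_vz.
have uC a : commute u (zexpg z a) by apply/zexpg_comm/hei4_uz.
pose P a := zexpg v a * u = u * (zexpg v a * zexpg z (- a)).
have PS m : P m <-> P (m + 1)%R.
  rewrite /P -zexpgS opprD -zexpgP.
  have -> : z^-1 * zexpg z (- m) = zexpg z (- m) * z^-1.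
    exact/commute_sym/commuteV/commute_sym/zexpg_comm.
  have -> : u * (v * zexpg v m * (zexpg z (- m) * z^-1)) =
      v * (u * (zexpg v m * zexpg z (- m))).
    rewrite [RHS]mulgA hei4_vu -!mulgA; congr (_ * (_ * _)).
    rewrite [LHS]mulgA; apply: commute_sym; apply: commuteM.
      apply/commute_sym/commuteV/commute_sym/zexpg_comm/commute_sym/hei4_vz.
    exact/commute_sym/commuteV/commute_sym/zexpg_comm.
  by rewrite -mulgA; split=> [->|/mulgI].
have P0 : P 0 by rewrite /P oppr0 /= !mulg1 mul1g.
by elim/int_rec: j => [//|k /PS|k]; rewrite -?PoszD ?addn1 // => Pk;
   apply/PS; have -> : (- k.+1%:Z + 1)%R = (- k%:Z)%R by lia.
Qed.

Lemma zexpgSr (K : groupType) (x : K) m : zexpg x m * x = zexpg x (m + 1)%R.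
Proof. by rewrite -zexpgS; apply/commute_sym/zexpg_comm. Qed.

Let P (p : int * int * int) : G :=
  let: (i, j, c) := p in zexpg u i * (zexpg v j * zexpg z c).

Let T (k : bool * bool) : G := hei4_nf (0, 0, 0, k)%R.

Let stepg (k : bool * bool) : G :=
  match k with
  | (false, false) => u | (false, true) => v
  | (true, false) => u^-1 | (true, true) => v^-1
  end.

Lemma hei4_nfE p k : hei4_nf (p, k) = P p * T k.
Proof. by case: p => [[i j] c]; rewrite /T /hei4_nf /= !mul1g. Qed.

Lemma hei4_step_neg k p : hei4_step k (hei4_step (quarter (quarter k)) p) = p.
Proof.
by case: p => [[i j] c]; case: k => [[] []] /=; do ![congr (_, _)]; ring.
Qed.

Lemma hei4_P_step k p : P p * stepg k = P (hei4_step k p).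
Proof.
have Pu q : P q * u = P (hei4_step (false, false) q).
  case: q => [[i j] c]; rewrite /P /= -!mulgA.
  rewrite -[zexpg z c * u](zexpg_comm _ hei4_uz) (mulgA _ u) hei4_zexpg_vu.
  by rewrite -!mulgA zexpgD addrC (mulgA (zexpg u i)) zexpgSr.
have Pv q : P q * v = P (hei4_step (false, true) q).
  case: q => [[i j] c]; rewrite /P /= -!mulgA.
  by rewrite -[zexpg z c * v](zexpg_comm _ hei4_vz) (mulgA _ v) zexpgSr.
case: k => [[] []] //.
- by rewrite -[in LHS](hei4_step_neg (false, true) p) -Pv mulgK.
- by rewrite -[in LHS](hei4_step_neg (false, false) p) -Pu mulgK.
Qed.

Lemma hei4_T_t k : T k * t = T (quarter k).
Proof.
case: k => [[] []]; rewrite /T /hei4_nf /= !mul1g ?mulg1 //; last by rewrite mulgA.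
by rewrite -!mulgA hei4_t4.
Qed.

Lemma hei4_T_u k : T k * u = stepg k * T k.
Proof.
have tu : t * u = v * t := hei4_tu.
have tv : t * v = u^-1 * t := hei4_tv.
have tui : t * u^-1 = v^-1 * t.
  by apply: (mulgI v); rewrite mulVKg mulgA -tu mulgK.
case: k => [[] []]; rewrite /T /hei4_nf /= !mul1g ?mulg1 //.
- by rewrite -!mulgA tu (mulgA t v) tv -!mulgA (mulgA t u^-1) tui -!mulgA.
- by rewrite -!mulgA tu (mulgA t v) tv -!mulgA.
Qed.

Lemma hei4_T_v k : T k * v = stepg (quarter k) * T k.
Proof.
have -> : v = t * u * t^-1 by rewrite [t * u]hei4_tu mulgK.
by rewrite 2!(mulgA (T k)) hei4_T_t hei4_T_u -hei4_T_t (mulgA _ (T k)) mulgK.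
Qed.

Lemma hei4_nf_gen s x : hei4_nf s * pgen hei4_rels x = hei4_nf (hei4_ract s (x, true)).
Proof.
case: s => p k; rewrite hei4_nfE -mulgA.
case: x; rewrite /hei4_ract -/u -/v -/z -/t.
- by rewrite hei4_T_u mulgA hei4_P_step -hei4_nfE.
- by rewrite hei4_T_v mulgA hei4_P_step -hei4_nfE.
- have -> : T k * z = z * T k.
    apply: commute_sym; rewrite /T /hei4_nf /= !mul1g.
    have tz : commute z t by apply/commute_sym/hei4_tz.
    by case: k => [[] []]; repeat (exact: tz || exact: commute1 || apply: commuteM).
  case: p => [[i j] c]; rewrite hei4_nfE mulgA; congr (_ * _).
  by rewrite /P /= -!mulgA zexpgSr.
- by rewrite hei4_T_t -hei4_nfE.
Qed.

Lemma hei4_nf_letter s x b :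
  hei4_nf s * wpi hei4_rels [:: (x, b)] = hei4_nf (hei4_ract s (x, b)).
Proof.
case: b; first exact: hei4_nf_gen.
apply: (mulIg (pgen hei4_rels x)); rewrite wpi_letter mulgVK hei4_nf_gen; congr hei4_nf.
by case: s x => [[[i j] c] [[] []]] [] /=; do ![congr (_, _)]; ring.
Qed.

Lemma hei4_nfP w : hei4_nf (hei4_st w) = wpi hei4_rels w.
Proof.
suff nfw s : hei4_nf (foldl hei4_ract s w) = hei4_nf s * wpi hei4_rels w.
  by rewrite [LHS]nfw /= !mul1g.
elim: w s => [|[x b] w IH] s; first by rewrite mulg1.
by rewrite [LHS]IH -hei4_nf_letter -mulgA -wpi_cons.
Qed.

Definition hei4_coord (g : G) : hei4_state := hei4_st (repr g).

Lemma hei4_coord_wpi w : hei4_coord (wpi hei4_rels w) = hei4_st w.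
Proof. by apply: hei4_ract_eq; apply: word_eq_repr. Qed.

Lemma hei4_coordK : cancel hei4_coord hei4_nf.
Proof. by move=> g; rewrite hei4_nfP /wpi reprK. Qed.

Lemma hei4_coordM g w :
  hei4_coord (g * wpi hei4_rels w) = foldl hei4_ract (hei4_coord g) w.
Proof.
have -> : g = wpi hei4_rels (repr g) by rewrite /wpi reprK.
by rewrite -wpi_cat !hei4_coord_wpi /hei4_st foldl_cat.
Qed.

End Hei4NormalForm.

(** * Kernels of x - 1 and of norms in an integral group ring *)

Lemma subrACA (V : zmodType) (a b c d : V) : (a - b) - (c - d) = (a - c) - (b - d).
Proof. by rewrite !opprD !opprK !addrA; congr (_ + _); rewrite addrAC. Qed.

(** A fixed chain has support stable under [f]; since [h] increases along orbits, a nonempty support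
    would be infinite. *)
Lemma push_fixed (K : choiceType) (f : K -> K) (h : K -> int) (a : {freeg K / int}) :
  injective f -> (forall k, h (f k) = h k + 1) -> push f a = a -> a = 0.
Proof.
move=> f_inj hf fa; apply/eqP; rewrite -dom_eq0; case da: (dom a) => [//|k s].
have domf l : l \in dom a -> f l \in dom a.
  by rewrite !mem_dom -{2}fa coeff_push.
have iter_dom n : iter n f k \in dom a.
  by elim: n => [|n IH]; [rewrite da mem_head|apply: domf].
have h_iter n : h (iter n f k) = h k + n%:Z.
  by elim: n => [|n IH]; rewrite ?addr0 //= hf IH -addrA -PoszD addn1.
pose m := (size (dom a)).+1.
have : (size [seq iter n f k | n <- iota 0 m] <= size (dom a))%N.
  apply: uniq_leq_size => [|_ /mapP[n _ ->] //].
  rewrite map_inj_uniq ?iota_uniq // => i j ij.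
  by have := h_iter i; rewrite ij h_iter => /addrI [].
by rewrite size_map size_iota ltnn.
Qed.

Lemma freeg_scale_eq0 (K : choiceType) (k : int) (a : {freeg K / int}) :
  k != 0 -> k *: a = 0 -> a = 0.
Proof.
move=> k0 ka; apply/eqP/freeg_eqP => x; rewrite coeff0.
have : coeff x (k *: a) = 0 by rewrite ka coeff0.
by rewrite coeffZ => /eqP; rewrite mulf_eq0 (negPf k0) => /eqP.
Qed.

Section CyclicSubgroups.
Variables (G : groupType) (x : G).
Implicit Types a b : {freeg G / int}.

Definition coboundary a := exists b, rmul x b - b = a.

Lemma coboundaryB a b : coboundary a -> coboundary b -> coboundary (a - b).
Proof.
move=> [a' aE] [b' bE]; exists (a' - b'); by rewrite raddfB /= -aE -bE subrACA.
Qed.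

Lemma coboundary0 : coboundary 0.
Proof. by exists 0; rewrite raddf0 subrr. Qed.

Lemma coboundaryN a : coboundary a -> coboundary (- a).
Proof. by rewrite -sub0r; apply/coboundaryB/coboundary0. Qed.

Lemma coboundaryD a b : coboundary a -> coboundary b -> coboundary (a + b).
Proof. by move=> ca cb; rewrite -[b]opprK; apply/coboundaryB/coboundaryN. Qed.

Lemma coboundary_trans a b c :
  coboundary (a - b) -> coboundary (b - c) -> coboundary (a - c).
Proof. by move=> ab bc; rewrite -[a](subrK b) -addrA; apply: coboundaryD. Qed.

Lemma coboundary_mul g : coboundary (<< (g * x)%g >> - << g >>).
Proof. by exists << g >>; rewrite rmulU. Qed.

Lemma coboundary_expg g n : coboundary (<< (g * x ^+ n)%g >> - << g >>).
Proof.
elim: n => [|n IH]; first by rewrite mulg1 subrr; apply: coboundary0.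
by rewrite expgSr mulgA; apply: coboundary_trans IH; apply: coboundary_mul.
Qed.

(** If [sec (p g)] lies in [g <x>], every [a] is congruent to its image under
    [sec \o p] modulo coboundaries.                                           *)
Lemma coboundary_section (K : choiceType) (p : G -> K) (sec : K -> G) a :
  (forall g, coboundary (<< g >> - << sec (p g) >>)) -> push p a = 0 -> coboundary a.
Proof.
move=> secP pa; rewrite -[a]subr0 -(raddf0 (push sec)) -pa /= push_comp.
move: a {pa}; apply: freeg_additive_ind => [|a b Ha Hb|g].
- by rewrite raddf0 subrr; apply: coboundary0.
- by rewrite raddfB /= subrACA; apply: coboundaryB.
- by rewrite pushU; apply: secP.
Qed.

Variables (m : nat) (h : G -> nat).
Hypothesis m_gt0 : (0 < m)%N.
Hypothesis x_order : (x ^+ m)%g = 1%g.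
Hypothesis h_lt : forall g, (h g < m)%N.
Hypothesis hx : forall g, h (g * x)%g = if ((h g).+1 < m)%N then (h g).+1 else 0%N.

Let proj i : {freeg G / int} -> {freeg G / int} :=
  linext (fun g => if h g == i then << g >> else 0 : {freeg G / int}).

(** The part of [a] on the transversal h = 0 has norm [a]: by invariance its translate by x^i is the
    part on h = i. *)
Lemma coboundary_kernel a : rmul x a = a ->
  exists b, \sum_(i < m) rmul (x ^+ i)%g b = a.
Proof.
move=> xa; exists (proj 0 a).
have projS i b : (i.+1 < m)%N -> proj i.+1 (rmul x b) = rmul x (proj i b).
  move=> im; move: b; apply: (@freeg_additive_ext _ _ (linext _ \o rmul x)
    (rmul x \o linext _)) => g /=.
  rewrite rmulU !linextU hx; case: (ltnP (h g).+1 m) => hm.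
    by rewrite eqSS; case: eqP; rewrite ?rmulU ?raddf0.
  case: eqP => //; case: eqP => [hi|]; last by rewrite raddf0.
  by rewrite hi leqNgt im in hm.
have projE i : (i < m)%N -> proj i a = rmul (x ^+ i)%g (proj 0 a).
  elim: i => [|i IH] im; first by rewrite rmul1.
  by rewrite -[in LHS]xa projS // IH ?(ltnW im) // rmulM expgSr.
transitivity (\sum_(i < m) proj i a); first by apply: eq_bigr => i _; rewrite (projE _ (ltn_ord i)).
move: a {xa projE}; apply: freeg_additive_ind => [|a b Ha Hb|g].
- by rewrite /proj big1 // => i _; rewrite raddf0.
- by rewrite -[in RHS]Ha -[in RHS]Hb -sumrB /proj; apply: eq_bigr => i _; rewrite raddfB.
rewrite (bigD1 (Ordinal (h_lt g))) //= /proj linextU eqxx big1 ?addr0 // => i.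
by rewrite linextU -val_eqE /= eq_sym => /negPf->.
Qed.

(** The map [p] slides g along g<x> to the transversal h = 0. It is constant on cosets, so it sends
    the norm of [a] to m times the image of [a]; that image is therefore 0, integral chains being
    torsion free. *)
Lemma norm_kernel a : \sum_(i < m) rmul (x ^+ i)%g a = 0 -> coboundary a.
Proof.
move=> na; pose p g := (g * x ^+ (m - h g))%g.
apply: (@coboundary_section _ p id) => [g|].
  by rewrite -opprB; apply/coboundaryN/coboundary_expg.
have px g : p (g * x)%g = p g.
  rewrite /p hx; case: ifP => hm; rewrite -mulgA -expgS; first by rewrite subnSK // ltnW.
  have -> : h g = m.-1.
    by have := h_lt g; move/negbT: hm; rewrite -leqNgt; lia.
  by rewrite subn0 expgS x_order -[(m - _)%N]/(m - m.-1)%N; congr (_ * _)%g;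
     rewrite mulg1 (_ : (m - m.-1 = 1)%N) //; lia.
have pxn i : push p (rmul (x ^+ i)%g a) = push p a.
  elim: i => [|i IH]; first by rewrite rmul1.
  rewrite expgSr -rmulM -[RHS]IH /rmul [LHS]push_comp; exact: eq_push.
apply: (@freeg_scale_eq0 _ m); first by rewrite -lt0n.
rewrite -[RHS](raddf0 (push p)) -na raddf_sum /= (eq_bigr (fun=> push p a)) //.
by rewrite sumr_const card_ord -natz scaler_nat.
Qed.

End CyclicSubgroups.

Section PresentedCyclic.
Variables (X : choiceType) (rels : seq (word X * word X)).
Implicit Types a b : {freeg (presented rels) / int}.

Lemma wpi_expg w n : (wpi rels w ^+ n)%g = wpi rels (flatten (nseq n w)).
Proof. by elim: n => [//|n IH]; rewrite expgS IH /= wpi_cat. Qed.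

Definition cyc_norm n (w : word X) : seq (int * word X) :=
  [seq (1, flatten (nseq i w)) | i <- iota 0 n].

Definition cyc_diff (w : word X) : seq (int * word X) := [:: (1, w); (-1, [::])].

Lemma rl_norm n w a : rl rels (cyc_norm n w) a = \sum_(i < n) rmul (wpi rels w ^+ i)%g a.
Proof.
rewrite rlE big_map -[n in iota 0 n]subn0 -/(index_iota 0 n) big_mkord.
by apply: eq_bigr => i _; rewrite scale1r wpi_expg.
Qed.

Lemma rl_diff w a : rl rels (cyc_diff w) a = rmul (wpi rels w) a - a.
Proof. by rewrite rlE !big_cons big_nil scale1r scaleN1r rmul1 addr0. Qed.

Definition lneg (l : seq (int * word X)) := [seq (- p.1, p.2) | p <- l].

Lemma rl_neg l a : rl rels (lneg l) a = - rl rels l a.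
Proof.
by rewrite !rlE big_map -sumrN; apply: eq_bigr => p _; rewrite scaleNr.
Qed.

End PresentedCyclic.

(** * Kernels in the group ring of Hei4, and the square grid *)

Section Hei4Kernels.
Notation wp := (wpi hei4_rels).
Notation gen x := [:: (x, true)].
Implicit Types a : {freeg Hei4 / int}.

Let t : word hei4_gen := gen Gt.
Let s : word hei4_gen := [:: (Gu, true); (Gt, true); (Gt, true)].
Let b : word hei4_gen := [:: (Gu, true); (Gt, true)].

Lemma hei4_wpi_eq v w : hei4_st v = hei4_st w -> wp v = wp w.
Proof. by rewrite -!hei4_nfP => ->. Qed.

Lemma hei4_nf_wpi p w : (hei4_nf p * wp w)%g = hei4_nf (foldl hei4_ract p w).
Proof.
elim: w p => [|[x e] w IH] p; first by rewrite mulg1.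
by rewrite wpi_cons mulgA hei4_nf_letter IH.
Qed.

Definition hei4_quarter (g : Hei4) : nat :=
  let: (_, k) := hei4_coord g in (k.1.*2 + k.2)%N.

Lemma hei4_quarter_lt g : (hei4_quarter g < 4)%N.
Proof. by rewrite /hei4_quarter; case: (hei4_coord g) => [p [[] []]]. Qed.

Lemma hei4_quarter_t g : hei4_quarter (g * wp t)%g =
  if ((hei4_quarter g).+1 < 4)%N then (hei4_quarter g).+1 else 0%N.
Proof.
by rewrite /hei4_quarter hei4_coordM; case: (hei4_coord g) => [p [[] []]].
Qed.

Lemma hei4_t_order : (wp t ^+ 4)%g = 1%g.
Proof. by rewrite wpi_expg -(wpi_nil hei4_rels); apply: hei4_wpi_eq. Qed.

(** Right multiplication by s moves (i, j) to a neighbour in the grid, so the parity of i + j serves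
    as residue for the group <s> of order 2. *)
Definition hei4_parity (g : Hei4) : nat :=
  let: (i, j, _, _) := hei4_coord g in odd (absz (i + j)%R).

Lemma hei4_parity_lt g : (hei4_parity g < 2)%N.
Proof. by rewrite /hei4_parity; case: (hei4_coord g) => [[[i j] c] k]; case: odd. Qed.

Lemma hei4_parity_s g : hei4_parity (g * wp s)%g =
  if ((hei4_parity g).+1 < 2)%N then (hei4_parity g).+1 else 0%N.
Proof.
rewrite /hei4_parity hei4_coordM; case: (hei4_coord g) => [[[i j] c] k].
have -> : (if ((odd (absz (i + j)%R)).+1 < 2)%N then (odd (absz (i + j)%R)).+1 else 0%N) =
  ~~ odd (absz (i + j)%R) by case: odd.
by case: k => [[] []] /=; congr nat_of_bool; lia.
Qed.

Lemma hei4_s_order : (wp s ^+ 2)%g = 1%g.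
Proof. by rewrite wpi_expg -(wpi_nil hei4_rels); apply: hei4_wpi_eq. Qed.

Definition hei4_height (g : Hei4) : int := let: (_, _, c, _) := hei4_coord g in c.

Lemma hei4_height_z g : hei4_height (g * wp (gen Gz))%g = hei4_height g + 1.
Proof. by rewrite /hei4_height hei4_coordM; case: (hei4_coord g) => [[[i j] c] k]. Qed.

Lemma hei4_z_kernel a : rmul (wp (gen Gz)) a = a -> a = 0.
Proof. by apply: (push_fixed (h := hei4_height)) hei4_height_z => g h /mulIg. Qed.

Lemma hei4_b4 : (wp b ^+ 4)%g = wp (gen Gz).
Proof. by rewrite wpi_expg; apply: hei4_wpi_eq. Qed.

Lemma hei4_b_kernel a : rmul (wp b) a = a -> a = 0.
Proof.
by move=> ba; apply: hei4_z_kernel; rewrite -hei4_b4 !expgS expg0 mulg1 -!rmulM !ba.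
Qed.

(** [Hei4] acts on the square grid of the plane through its quotient by [<z>];
    an element is seen as the edge leaving [(i, j)] in the direction [i^k].
    [grid_square] is the lower left corner of the square to the left of this
    edge, [grid_vertical] the signed edge, taken to be [0] if horizontal.      *)
Definition grid_square (e : hei4_state) : int * int :=
  let: (i, j, _, k) := e in
  match k with
  | (false, false) => (i, j) | (false, true) => (i - 1, j)
  | (true, false) => (i - 1, j - 1) | (true, true) => (i, j - 1)
  end.

Definition grid_vertical (e : hei4_state) : {freeg (int * int)%type / int} :=
  let: (i, j, _, k) := e in
  match k with
  | (false, true) => << (i, j) >> | (true, true) => - << (i, j - 1) >>
  | _ => 0
  end.

Definition vertical_part : {freeg Hei4 / int} -> {freeg (int * int)%type / int} :=
  linext (fun g => grid_vertical (hei4_coord g)).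

HB.instance Definition _ := GRing.Additive.on vertical_part.

Definition square_part : {freeg Hei4 / int} -> {freeg (int * int)%type / int} :=
  push (fun g => grid_square (hei4_coord g)).

HB.instance Definition _ := GRing.Additive.on square_part.

Lemma vertical_partU g : vertical_part << g >> = grid_vertical (hei4_coord g).
Proof. exact: linextU. Qed.

Lemma vertical_part_z a : vertical_part (rmul (wp (gen Gz)) a) = vertical_part a.
Proof.
move: a; apply: (@freeg_additive_ext _ _ (vertical_part \o rmul (wp (gen Gz))) vertical_part).
move=> g /=; rewrite rmulU !vertical_partU hei4_coordM.
by case: (hei4_coord g) => [[[i j] c] k].
Qed.

(** The element s runs to the other end of the edge and turns back, so it reverses the edge. *)
Lemma vertical_part_s a : vertical_part (rmul (wp s) a) = - vertical_part a.
Proof.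
move: a; apply: (@freeg_additive_ext _ _ (vertical_part \o rmul (wp s)) (-%R \o vertical_part)).
move=> g /=; rewrite rmulU !vertical_partU hei4_coordM.
case: (hei4_coord g) => [[[i j] c] [[] []]] /=; rewrite ?oppr0 ?opprK ?addrK //.
Qed.

Let shift (p : int * int) : int * int := (p.1 + 1, p.2).

(** The boundary of a square contains its right side minus its left side, hence
    a finite chain of squares whose boundary has no vertical part vanishes.   *)
Lemma vertical_part_b a : vertical_part (rl hei4_rels (cyc_norm 4 b) a) =
  push shift (square_part a) - square_part a.
Proof.
move: a; apply: (@freeg_additive_ext _ _ (vertical_part \o rl hei4_rels (cyc_norm 4 b))
  ((push shift \o square_part) \- square_part)) => g /=.
rewrite rlE /cyc_norm big_map raddf_sum /= !big_cons big_nil !scale1r !rmulU /=.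
rewrite !vertical_partU !hei4_coordM /square_part !pushU.
case: (hei4_coord g) => [[[i j] c] [[] []]] /=; rewrite /shift /= ?add0r ?addr0 ?addrK ?subrK.
- by rewrite addrC.
- by rewrite addrC.
- by rewrite ?subrK.
- by rewrite ?subrK.
Qed.

(** The element b = u t follows an edge and turns left, hence goes round the square, and b^4 = z
    raises the height by 1: the elements with a given square form one coset of <b>. *)
Lemma square_part_kernel a : square_part a = 0 -> coboundary (wp b) a.
Proof.
pose sec (p : int * int) := hei4_nf (p.1, p.2, 0, (false, false)).
apply: (@coboundary_section _ _ _ _ sec) => g.
pose Q e := coboundary (wp b) (<< hei4_nf e >> - << sec (grid_square e) >>).
have Qb e : Q (foldl hei4_ract e b) <-> Q e.
  have -> : Q (foldl hei4_ract e b) = coboundary (wp b)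
      (<< (hei4_nf e * wp b)%g >> - << sec (grid_square e) >>).
    rewrite /Q hei4_nf_wpi; congr (coboundary _ (_ - << sec _ >>)).
    by case: e => [[[i j] c] [[] []]] /=; rewrite ?addrK.
  have cb := coboundary_mul (wp b) (hei4_nf e).
  split; first by apply: coboundary_trans; rewrite -opprB; apply: coboundaryN.
  exact: coboundary_trans cb.
(* Four steps of b make one step of z, so the height can be brought to 0. *)
have Q0 i j c : Q (i, j, c, (false, false)).
  have Qc m : Q (i, j, m, (false, false)) <-> Q (i, j, m + 1, (false, false)).
    have <- : foldl hei4_ract (i, j, m, (false, false)) (b ++ b ++ b ++ b) =
        (i, j, m + 1, (false, false)) by rewrite /=; do ![congr (_, _)]; ring.
    by rewrite !foldl_cat 4!Qb.
  elim/int_rec: c => [|k /Qc|k].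
  - by rewrite /Q /sec subrr; apply: coboundary0.
  - by rewrite -PoszD addn1.
  - by move=> Qk; apply/Qc; have -> : (- k.+1%:Z + 1)%R = (- k%:Z)%R by lia.
rewrite -[g in << g >>]hei4_coordK -/(Q _); case: (hei4_coord g) => [[[i j] c] k].
by case: k => [[] []]; do 4?[exact: Q0 | apply/Qb => /=].
Qed.

End Hei4Kernels.

(** * The resolution of Hei4 *)

Section Hei4Resolution.
Notation word4 := (word hei4_gen).
Notation zl := (seq (int * word4)).
Notation gen x := [:: (x, true)].
Notation R4 := hei4_rels.

Let t : word4 := gen Gt.
Let s : word4 := [:: (Gu, true); (Gt, true); (Gt, true)].
Let b : word4 := [:: (Gu, true); (Gt, true)].

(** [wl p] and [sl p] are the differentials, from the degrees of parity [p], of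
    the periodic resolutions of [Z] over the stabiliser [<t>] of a vertex, and
    of the sign module over the stabiliser [<s>], [s = u t^2], of an edge;
    [fl] lifts the boundary [u - 1] from edges to vertices.                   *)
Definition wl (p : bool) : zl := if p then cyc_diff t else cyc_norm 4 t.
Definition sl (p : bool) : zl := if p then cyc_norm 2 s else cyc_diff s.
Definition fl (p : bool) : zl :=
  if p then [:: (1, [::]); (1, t); (-1, gen Gu); (-1, b)] else cyc_diff (gen Gu).

Lemma wl_exact p a : rl R4 (wl p) a = 0 -> exists c, rl R4 (wl (~~ p)) c = a.
Proof.
case: p; rewrite /= ?rl_norm ?rl_diff => a0.
  have ta : rmul (wpi R4 t) a = a by apply/eqP; rewrite -subr_eq0 a0.
  have [c cE] := coboundary_kernel hei4_quarter_lt hei4_quarter_t ta.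
  by exists c; rewrite rl_norm.
have [c cE] := norm_kernel (isT : (0 < 4)%N) hei4_t_order hei4_quarter_lt hei4_quarter_t a0.
by exists c; rewrite rl_diff.
Qed.

Lemma sl_exact p a : rl R4 (sl p) a = 0 -> exists c, rl R4 (sl (~~ p)) c = a.
Proof.
case: p; rewrite /= ?rl_norm ?rl_diff => a0.
  have [c cE] := norm_kernel (isT : (0 < 2)%N) hei4_s_order hei4_parity_lt hei4_parity_s a0.
  by exists c; rewrite rl_diff.
have sa : rmul (wpi R4 s) a = a by apply/eqP; rewrite -subr_eq0 a0.
have [c cE] := coboundary_kernel hei4_parity_lt hei4_parity_s sa.
by exists c; rewrite rl_norm.
Qed.

Definition zlz : zl := cyc_diff (gen Gz).

Lemma zlz_inj a : rl R4 zlz a = 0 -> a = 0.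
Proof. by rewrite rl_diff => /eqP; rewrite subr_eq0 => /eqP /hei4_z_kernel. Qed.

(** The generators in degree [n] are indexed by [0] (vertex), [1] (vertex x
    fibre, from degree 1), [2] (edge, from degree 1), [3] (edge x fibre, from
    degree 2) and, in degrees 2 and 3, [4]: a cell of the column over a square,
    with stabiliser [<b>], [b = u t].  In degree 2 the latter is attached along
    the helix through [1, b, b^2, b^3, b^4 = z].                              *)
Definition hei4_rank n : nat := match n with 0 => 1 | 1 => 3 | 2 | 3 => 5 | _ => 4 end.

Definition hei4_periodic (p : bool) (j : nat) : seq (zl * nat) :=
  match j with
  | 0 => [:: (wl (~~ p), 0)]
  | 1 => [:: (zlz, 0); (lneg (wl p), 1)]
  | 2 => [:: (fl p, 0); (lneg (sl p), 2)]
  | _ => [:: (zlz, 2); (lneg (fl (~~ p)), 1); (sl (~~ p), 3)]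
  end%N.

(** In degree 2 the column of the cell 4 is the Fox derivative of (u t)^4 z^-1. In degree 3, b - 1
    turns the norm of b into z - 1, which the cells 3 and 1 cancel. *)
Definition hei4_d (n j : nat) : seq (zl * nat) :=
  if (j < hei4_rank n.+1)%N then
    if j == 4%N then
      if n == 1%N then
        [:: (cyc_norm 4 b, 2%N); ([seq (p.1, p.2 ++ gen Gu) | p <- cyc_norm 4 b], 0%N);
            ([:: (-1, [::])], 1%N)]
      else [:: (cyc_diff b, 4%N); ([:: (-1, [::])], 3%N); ([:: (-1, gen Gu)], 1%N)]
    else hei4_periodic (odd n) j
  else [::].

Lemma hei4_d_out n j : (hei4_rank n.+1 <= j)%N -> hei4_d n j = [::].
Proof. by rewrite /hei4_d ltnNge => ->. Qed.

Notation md4 := (md R4 hei4_rank hei4_d).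

(** The generator v has no cell in degree 1: its derivative is that of t u t^-1, namely t du + (1 -
    v) dt. *)
Definition hei4_der (x : hei4_gen) : seq (zl * nat) :=
  match x with
  | Gu => [:: ([:: (1, [::])], 2%N)]
  | Gv => [:: ([:: (1, t)], 2%N); ([:: (1, [::]); (-1, gen Gv)], 0%N)]
  | Gz => [:: ([:: (1, [::])], 1%N)]
  | Gt => [:: ([:: (1, [::])], 0%N)]
  end.

Definition hei4_fox_gen (j : nat) : hei4_gen := match j with 0 => Gt | 1 => Gz | _ => Gu end.

Lemma hei4_i0 (j : 'I_(hei4_rank 0)) : j = ord0.
Proof. exact: ord1. Qed.

Lemma hei4_der_d x : md4 0 (vec R4 (hei4_rank 1) (hei4_der x) << 1%g >>) =
  << (wpi R4 (wgen x), ord0) >> - << (1%g, ord0) >>.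
Proof.
rewrite (md_vec hei4_d_out).
rewrite (@vec_eq _ _ _ hei4_st _ _ _ [:: (cyc_diff (gen x), 0%N)] _ hei4_nfP).
  rewrite /vec big_seq1 rl_diff rmulU mul1g raddfB /=.
  by rewrite !(inj_ord (ord0 : 'I_(hei4_rank 0))).
by case: x; vm_compute.
Qed.

Lemma hei4_fox_gen_d (j : 'I_(hei4_rank 1)) :
  vec R4 (hei4_rank 1) (hei4_der (hei4_fox_gen j)) << 1%g >> = << (1%g, j) >>.
Proof.
have -> : hei4_der (hei4_fox_gen j) = [:: ([:: (1, [::])], nat_of_ord j)].
  by case: j => [[|[|[|j]]] jP].
by rewrite /vec big_seq1 rl1 rmulU mulg1 inj_ord.
Qed.

(** A 2-chain bounding the Fox derivative of the [i]-th relation.              *)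
Definition hei4_rel_cells (i : nat) : seq (zl * nat) :=
  let zv := [:: (Gz, true); (Gv, true)] in
  let zt := [:: (Gz, true); (Gt, true)] in
  match i with
  | 0 => [:: ([:: (-1, [::])], 3%N)]
  | 1 => [:: ([:: (-1, t)], 3%N); (cyc_diff (gen Gv), 1%N)]
  | 2 => [:: ([:: (-1, [::])], 1%N)]
  | 3 => [:: ([:: (1, [::])], 0%N)]
  | 4 => [:: ([:: (1, [::])], 4%N); ([:: (1, zv); (1, zt)], 2%N); ([:: (-1, gen Gz)], 0%N)]
  | 5 => [::]
  | _ => [:: ([:: (-1, [:: (Gu, false)])], 2%N)]
  end.

Lemma hei4_rels_d q : q \in R4 -> exists y, md4 1 y =
  vec R4 (hei4_rank 1) (fox hei4_der q.1) << 1%g >> -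
  vec R4 (hei4_rank 1) (fox hei4_der q.2) << 1%g >>.
Proof.
move=> qR; pose i := index q R4.
have -> : q = nth ([::], [::]) R4 i by rewrite nth_index.
exists (vec R4 (hei4_rank 2) (hei4_rel_cells i) << 1%g >>); rewrite (md_vec hei4_d_out).
have : (i < 7)%N by rewrite -[7%N]/(size R4) index_mem.
move: i => i i7; apply/eqP; rewrite eq_sym subr_eq -vec_cat eq_sym; apply/eqP.
apply: (vec_eq _ hei4_nfP).
by move: i i7; do 7!(case; first by vm_compute).
Qed.

Lemma hei4_dd n x : md4 n (md4 n.+1 x) = 0.
Proof.
rewrite [md4 n.+1 x](mdE hei4_d_out) raddf_sum big1 // => j _; rewrite /= (md_vec hei4_d_out).
apply: (vec0P hei4_nfP).
case: j {x} => [j jP] /=; case: n jP => [|[|[|n]]] jP.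
- by move: j jP; do 5!(case; first by vm_compute).
- by move: j jP; do 5!(case; first by vm_compute).
- by move: j jP; do 4!(case; first by vm_compute).
(* From here on the columns depend only on the parity of n; the case on n separates a target of rank
   5, in degree 3, from those of rank 4. *)
move: j jP; do 4!(case; first by move=> _; rewrite /ldl /hei4_d /= negbK; case: (n) => [|m]; case: (odd _); vm_compute).
by [].
Qed.

End Hei4Resolution.

Arguments hei4_rank : simpl never.
Arguments lneg : simpl never.
Arguments cyc_norm : simpl never.
Arguments cyc_diff : simpl never.
Arguments sl : simpl never.
Arguments wl : simpl never.
Arguments fl : simpl never.

(** * Exactness of the resolution of Hei4 in degrees 2 and above *)

Section Hei4Exactness.
Notation R4 := hei4_rels.
Notation md4 := (md R4 hei4_rank hei4_d).
Notation gen x := [:: (x, true)].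
Notation F n := {freeg (Hei4 * 'I_(hei4_rank n)) / int}.

Lemma comp_md4 n i (x : F n.+1) : (0 < n)%N -> comp 4 x = 0 -> (i < hei4_rank n)%N ->
  comp i (md4 n x) =
    \sum_(j < 4) \sum_(e <- hei4_periodic (odd n) j | e.2 == i) rl R4 e.1 (comp j x).
Proof.
move=> n_gt0 x4 ir; rewrite (comp_md hei4_d_out) //.
case: n n_gt0 x x4 ir => [//|[|[|n]]] _ x x4 ir; last first.
- by apply: eq_bigr => j _; rewrite /hei4_d /= ltn_ord; case: j => [[|[|[|[|]]]]].
- rewrite big_ord_recr /= x4 [X in _ + X]big1 ?addr0 => [|e _]; last by rewrite raddf0.
  by apply: eq_bigr => -[[|[|[|[|j]]]]].
- rewrite big_ord_recr /= x4 [X in _ + X]big1 ?addr0 => [|e _]; last by rewrite raddf0.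
  by apply: eq_bigr => -[[|[|[|[|j]]]]].
Qed.

Lemma comp_md4_cell n i j a : (j < 4)%N -> (j < hei4_rank n.+1)%N -> (i < hei4_rank n)%N ->
  comp i (md4 n (inj _ j a)) =
    \sum_(e <- hei4_periodic (odd n) j | e.2 == i) rl R4 e.1 a.
Proof.
move=> j4 jr ir; rewrite (md_inj hei4_d_out) comp_vec // /hei4_d jr.
by rewrite ltn_eqF.
Qed.

Definition boundary4 n (x : F n) := exists y, md4 n y = x.

Lemma boundary4_sub n (x : F n) y : boundary4 (x - md4 n y) -> boundary4 x.
Proof. by case=> w wE; exists (w + y); rewrite raddfD /= wE subrK. Qed.

Lemma md4_sub n (x : F n.+1) y : md4 n x = 0 -> md4 n (x - md4 n.+1 y) = 0.
Proof. by move=> x0; rewrite raddfB /= x0 hei4_dd subrr. Qed.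

Lemma comp4_md4_cell n j a : (j < 4)%N -> comp 4 (md4 n (inj _ j a)) = 0.
Proof.
move=> j4; have [r4|/comp_out->//] := ltnP 4 (hei4_rank n).
have [jr|rj] := ltnP j (hei4_rank n.+1); last by rewrite inj_out // !raddf0.
rewrite comp_md4_cell //.
by case: j j4 {jr} => [|[|[|[|]]]] //= _; rewrite !big_cons big_nil.
Qed.

(** The matrix is triangular for the order 3, 2, 1, 0. The hypothesis on [a] solves the coordinate 3
    against its diagonal entry; then rows 2, 1, 0 in turn involve a single surviving coordinate,
    which the exactness of [sl] and [wl] clears. *)
Lemma hei4_exact_tail n (x : F n.+2) a : md4 n.+1 x = 0 -> comp 4 x = 0 ->
  rl R4 (sl (odd n.+1)) a = comp 3 x -> boundary4 x.
Proof.
move=> x0 x4 aE.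
have r2 : (4 <= hei4_rank n.+2)%N by case: (n) => [|[]].
have r5 : (hei4_rank n.+2 <= 5)%N by case: (n) => [|[]].
have r3 : (4 <= hei4_rank n.+3)%N by case: (n).
have cell i j c : (i < 4)%N -> (j < 4)%N -> comp i (md4 n.+2 (inj _ j c)) =
    \sum_(e <- hei4_periodic (odd n.+2) j | e.2 == i) rl R4 e.1 c.
  by move=> i4 j4; apply: comp_md4_cell; rewrite // ?(leq_trans _ r2) ?(leq_trans _ r3).
pose sub1 (y : F n.+2) j c := y - md4 n.+2 (inj _ j c).
have sub1_d y j c : md4 n.+1 y = 0 -> md4 n.+1 (sub1 y j c) = 0 by apply: md4_sub.
have sub1_4 y j c : (j < 4)%N -> comp 4 y = 0 -> comp 4 (sub1 y j c) = 0.
  by move=> j4 y4; rewrite raddfB /= comp4_md4_cell // y4 subrr.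
have subE y i j c : (i < 4)%N -> (j < 4)%N -> comp i (sub1 y j c) = comp i y -
    \sum_(e <- hei4_periodic (odd n.+2) j | e.2 == i) rl R4 e.1 c.
  by move=> i4 j4; rewrite raddfB /= cell.
have row i (y : F n.+2) : md4 n.+1 y = 0 -> comp 4 y = 0 -> (i < hei4_rank n.+1)%N ->
    \sum_(j < 4) \sum_(e <- hei4_periodic (odd n.+1) j | e.2 == i) rl R4 e.1 (comp j y) = 0.
  by move=> y0 y4 ir; rewrite -comp_md4 // y0 raddf0.
have r1 : (2 < hei4_rank n.+1)%N by case: (n) => [|[|[]]].
apply: (@boundary4_sub _ _ (inj _ 3 a)); rewrite -/(sub1 x 3 a).
have y4 := sub1_4 x 3 a isT x4; have y0 := sub1_d x 3 a x0.
have y3 : comp 3 (sub1 x 3 a) = 0.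
  by rewrite subE // !big_cons big_nil /= negbK addr0 aE subrr.
move: (sub1 x 3 a) y4 y0 y3 => y {x x0 x4 a aE} y4 y0 y3.
have b1 : bump 0 0 = 1%N := erefl; have b2 : bump 0 1 = 2%N := erefl.
have b3 : bump 0 2 = 3%N := erefl.
have := row 2 y y0 y4 r1.
rewrite !big_ord_recl big_ord0 /= !big_cons !big_nil /= ?b1 ?b2 ?b3 y3 raddf0 !addr0 !add0r.
rewrite rl_neg => /eqP; rewrite oppr_eq0 => /eqP /sl_exact [a2 a2E].
(* The sign compensates the [lneg] on the diagonal. *)
apply: (@boundary4_sub _ _ (inj _ 2 (- a2))); rewrite -/(sub1 y 2 (- a2)).
have w4 := sub1_4 y 2 (- a2) isT y4; have w0 := sub1_d y 2 (- a2) y0.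
have w3 : comp 3 (sub1 y 2 (- a2)) = 0.
  by rewrite subE // !big_cons big_nil /= subr0 y3.
have w2 : comp 2 (sub1 y 2 (- a2)) = 0.
  by rewrite subE // !big_cons big_nil /= addr0 rl_neg opprK raddfN /= -a2E /= !negbK subrr.
move: (sub1 y 2 (- a2)) w4 w0 w3 w2 => w {y y4 y0 y3 a2 a2E} w4 w0 w3 w2.
have := row 1 w w0 w4 (ltnW r1).
rewrite !big_ord_recl big_ord0 /= !big_cons !big_nil /= ?b1 ?b2 ?b3 w3 raddf0 !addr0 !add0r.
rewrite rl_neg => /eqP; rewrite oppr_eq0 => /eqP /wl_exact [a1 a1E].
apply: (@boundary4_sub _ _ (inj _ 1 (- a1))); rewrite -/(sub1 w 1 (- a1)).
have x4 := sub1_4 w 1 (- a1) isT w4; have x0 := sub1_d w 1 (- a1) w0.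
have x3 : comp 3 (sub1 w 1 (- a1)) = 0.
  by rewrite subE // !big_cons big_nil /= subr0 w3.
have x2 : comp 2 (sub1 w 1 (- a1)) = 0.
  by rewrite subE // !big_cons big_nil /= subr0 w2.
have x1 : comp 1 (sub1 w 1 (- a1)) = 0.
  by rewrite subE // !big_cons big_nil /= addr0 rl_neg opprK raddfN /= -a1E /= !negbK subrr.
move: (sub1 w 1 (- a1)) x4 x0 x3 x2 x1 => x {w w4 w0 w3 w2 a1 a1E} x4 x0 x3 x2 x1.
have := row 0 x x0 x4 (ltnW (ltnW r1)).
rewrite !big_ord_recl big_ord0 /= !big_cons !big_nil /= ?b1 ?b2 ?b3 x1 x2 !raddf0 !addr0.
move=> /wl_exact [a0 a0E].
exists (inj _ 0 a0); apply/eqP; rewrite eq_sym -subr_eq0; apply/eqP.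
rewrite -/(sub1 x 0 a0); apply: comp_eq0 => i ir.
have [i4|] := ltnP i 4; last first.
  rewrite leq_eqVlt => /orP[/eqP<-|i5]; first exact: sub1_4.
  by have := leq_trans ir r5; rewrite ltnNge i5.
rewrite subE //; move: i i4 {ir}; case=> [|[|[|[|//]]]] _.
- by rewrite !big_cons big_nil /= addr0 -a0E /= !negbK subrr.
- by rewrite !big_cons big_nil /= subr0 x1.
- by rewrite !big_cons big_nil /= subr0 x2.
- by rewrite !big_cons big_nil /= subr0 x3.
Qed.

(** [z - 1] is injective and commutes with [s - 1], which kills [s + 1].       *)
Lemma hei4_sz_kernel a c :
  rl R4 zlz a = rl R4 (sl true) c -> exists a', rl R4 (sl true) a' = a.
Proof.
move=> zac; apply: (@sl_exact false); apply: zlz_inj.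
have -> : rl R4 zlz (rl R4 (sl false) a) = rl R4 (sl false) (rl R4 zlz a).
  by rewrite -!rl_lmulz; apply: (rl_eq _ hei4_nfP); vm_compute.
rewrite zac -rl_lmulz -[RHS](raddf0 (rl R4 [::])).
by rewrite (@rl_eq _ _ _ hei4_st _ _ [::] _ hei4_nfP) ?raddf0 ?rlE ?big_nil //; vm_compute.
Qed.

(** From degree 3 on there is a row 3, whose only entry on the cells 0 to 3 is [sl]; it provides the
    preimage that [hei4_exact_tail] asks for. *)
Lemma hei4_exact_even n (x : F n.+3) : md4 n.+2 x = 0 -> comp 4 x = 0 -> boundary4 x.
Proof.
move=> x0 x4; have r3 : (3 < hei4_rank n.+2)%N by case: (n) => [|[]].
have := @comp_md4 n.+2 3 x isT x4 r3; rewrite x0 raddf0.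
rewrite !big_ord_recl big_ord0 /= !big_cons !big_nil /= !addr0 !add0r.
by move=> /esym/sl_exact[a aE]; apply: (@hei4_exact_tail _ _ a); rewrite // -aE /= !negbK.
Qed.

(** Only the two lowest cases see the column cell. In degree 3, b - 1 is injective on its
    coordinate; in degree 2 row 3 is missing, and the grid must clear the column cell before
    [hei4_sz_kernel] handles the coordinate 3. *)
Lemma hei4_exactS n (x : F n.+2) : md4 n.+1 x = 0 -> boundary4 x.
Proof.
case: n x => [|[|n]] x x0; last by apply: hei4_exact_even; rewrite // comp_out.
- have row2 (y : F 2) : md4 1 y = 0 -> rl R4 zlz (comp 3 y) +
      rl R4 (cyc_norm 4 [:: (Gu, true); (Gt, true)]) (comp 4 y) = rl R4 (sl true) (comp 2 y).
    move=> y0; have := @comp_md _ _ _ _ hei4_d_out 1 2 y isT; rewrite y0 raddf0.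
    rewrite !big_ord_recl big_ord0 /= !big_cons !big_nil /= !addr0 !add0r rl_neg.
    by move=> /esym/eqP; rewrite addrC subr_eq0 => /eqP.
  have vz a : vertical_part (rl R4 zlz a) = 0.
    by rewrite rl_diff raddfB /= vertical_part_z subrr.
  have vs a : vertical_part (rl R4 (sl true) a) = 0.
    rewrite rl_norm !big_ord_recl big_ord0 addr0 raddfD /= rmul1.
    by rewrite [X in rmul X]expg1 vertical_part_s subrr.
  (* In the vertical part of row 2, z - 1 and 1 + s vanish; what is left makes the finite chain of
     squares invariant under a shift, hence 0. *)
  have [a aE] : coboundary (wpi R4 [:: (Gu, true); (Gt, true)]) (comp 4 x).
    apply: square_part_kernel.
    apply: (@push_fixed _ (fun p : int * int => (p.1 + 1, p.2)) fst) => [[i j] [k l]|p|].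
    - by move=> [/addIr -> ->].
    - by [].
    apply/eqP; rewrite -subr_eq0 -vertical_part_b; apply/eqP.
    by have := congr1 vertical_part (row2 x x0); rewrite raddfD /= vz vs add0r.
  apply: (@boundary4_sub _ _ (inj _ 4 a)); set x' := x - _.
  have x'0 : md4 1 x' = 0 by apply: md4_sub.
  have x'4 : comp 4 x' = 0.
    rewrite raddfB /= (md_inj hei4_d_out) comp_vec // !big_cons big_nil /= addr0.
    by rewrite rl_diff aE subrr.
  have := row2 x' x'0; rewrite x'4 raddf0 addr0 => /hei4_sz_kernel[c cE].
  exact: (@hei4_exact_tail _ _ c).
- apply: hei4_exact_even => //; apply: hei4_b_kernel.
  have := @comp_md _ _ _ _ hei4_d_out 2 4 x isT; rewrite x0 raddf0.
  rewrite !big_ord_recl big_ord0 /= !big_cons !big_nil /= !addr0 !add0r rl_diff.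
  by move=> /esym/eqP; rewrite subr_eq0 => /eqP.
Qed.

Definition hei4_resolution : resolution Hei4.
Proof.
exists (fun n => 'I_(hei4_rank n)) (fun n => md4 n) (@deg (Hei4 * 'I_(hei4_rank 0))%type).
- exact: md_eq.
- exact: deg_gact.
- exact: hei4_dd.
- exact: (fox_aug hei4_der_d hei4_fox_gen_d).
- by move=> k; exists << k *g (1%g, ord0) >>; apply: degU.
- exact: (fox_exact0 hei4_i0 hei4_der_d).
- case=> [|n] x; last exact: hei4_exactS.
  exact: (fox_exact1 hei4_der_d hei4_rels_d hei4_fox_gen_d).
Defined.

End Hei4Exactness.

(** * The resolution of Hei *)

Section HeiResolution.
Notation RH := hei_rels.
Notation wp := (wpi hei_rels).
Notation gen x := [:: (x, true)].
Notation zl := (seq (int * word hei_gen)).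
Implicit Types a : {freeg Hei / int}.

Definition hei_st (w : word hei_gen) : int * int * int := hei4_act (hei_incl_word w) (0, 0, 0).

Lemma hei_nfP w : hei_nf (hei_st w) = wp w.
Proof. by rewrite -hei_nfE. Qed.

Definition hei_coord (g : Hei) : int * int * int := hei_st (repr g).

Lemma hei_coordK : cancel hei_coord hei_nf.
Proof. by move=> g; rewrite hei_nfP /wpi reprK. Qed.

(** The left action of Hei commutes with right multiplication by v^k z^l, a translation of the last
    two coordinates. *)
Lemma hei_act_translate w i j c k l :
  hei4_act (hei_incl_word w) (i, j + k, c + l) =
  let: (i', j', c') := hei4_act (hei_incl_word w) (i, j, c) in (i', j' + k, c' + l).
Proof.
elim: w => [//|[x e] w IH] /=; rewrite IH.
case: (hei4_act _ _) => [[i' j'] c'].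
by case: x; case: e => /=; do ![congr (_, _)]; ring.
Qed.

Lemma hei_coordM g w : hei_coord (g * wp w)%g = hei4_act (hei_incl_word (repr g)) (hei_st w).
Proof.
have -> : (g * wp w)%g = wp (repr g ++ w) by rewrite wpi_cat /wpi reprK.
have -> : hei4_act (hei_incl_word (repr g)) (hei_st w) = hei_st (repr g ++ w).
  by rewrite /hei_st /hei_incl_word map_cat /hei4_act foldr_cat.
apply: hei4_act_eq; apply/presented_eqP.
rewrite -!hei_incl_wordE -!(presented_lift_pi hei_incl_rels).
by congr presented_lift; rewrite reprK.
Qed.

Lemma hei_coord_z g : hei_coord (g * wp (gen Hz))%g =
  let: (i, j, c) := hei_coord g in (i, j, c + 1).
Proof.
rewrite hei_coordM /hei_st /= -[X in (0, X, _)](addr0 0) hei_act_translate.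
by rewrite /hei_coord /hei_st; case: (hei4_act _ _) => [[i j] c]; rewrite addr0.
Qed.

Lemma hei_z_kernel a : rmul (wp (gen Hz)) a = a -> a = 0.
Proof.
apply: (@push_fixed _ _ (fun g => (hei_coord g).2)) => [g h /mulIg //|g].
by rewrite hei_coord_z; case: (hei_coord g) => [[i j] c].
Qed.

Definition hei_plane (g : Hei) : int * int := (hei_coord g).1.

Lemma hei_plane_z g : hei_plane (g * wp (gen Hz))%g = hei_plane g.
Proof. by rewrite /hei_plane hei_coord_z; case: (hei_coord g) => [[i j] c]. Qed.

Lemma hei_plane_zv g : hei_plane (g * wp [:: (Hz, true); (Hv, true)])%g =
  ((hei_plane g).1, (hei_plane g).2 + 1).
Proof.
rewrite /hei_plane hei_coordM /hei_st /= -addrA hei_act_translate.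
by rewrite /hei_coord /hei_st; case: (hei4_act _ _) => [[i j] c].
Qed.

Lemma hei_plane_kernel a : push hei_plane a = 0 -> coboundary (wp (gen Hz)) a.
Proof.
pose sec (p : int * int) := hei_nf (p, 0).
apply: (@coboundary_section _ _ _ _ sec) => g; rewrite -{1}(hei_coordK g) /hei_plane.
case: (hei_coord g) => p c /=.
pose Q m := coboundary (wp (gen Hz)) (<< hei_nf (p, m) >> - << sec p >>).
have Qc m : Q m <-> Q (m + 1).
  have nfz : hei_nf (p, m + 1) = (hei_nf (p, m) * wp (gen Hz))%g.
    by case: (p) => i j; rewrite /hei_nf -!mulgA -zexpgSr.
  have cz := coboundary_mul (wp (gen Hz)) (hei_nf (p, m)).
  rewrite /Q nfz; split; first exact: coboundary_trans cz.
  by apply: coboundary_trans; rewrite -opprB; apply: coboundaryN.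
rewrite -/(Q c); elim/int_rec: c => [|k /Qc|k].
- by rewrite /Q subrr; apply: coboundary0.
- by rewrite -PoszD addn1.
- by move=> Qk; apply/Qc; have -> : (- k.+1%:Z + 1)%R = (- k%:Z)%R by lia.
Qed.

(** In degree 1 the generators are [u, v, z]; in degree 2, the relations
    [u v = z v u], [u z = z u], [v z = z v].                                  *)
Definition hei_rank n : nat := match n with 0 => 1 | 1 | 2 => 3 | 3 => 1 | _ => 0 end.

Definition hei_dz : zl := cyc_diff (gen Hz).
Definition hei_dzv : zl := cyc_diff [:: (Hz, true); (Hv, true)].
Definition hei_zu : zl := [:: (1, gen Hz); (-1, gen Hu)].

(** The columns in degree 2 are the Fox derivatives of z v u, z u, v z minus those of u v, u z, z
    v. *)
Definition hei_d (n j : nat) : seq (zl * nat) :=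
  match n, j with
  | 0, 0 => [:: (cyc_diff (gen Hu), 0%N)]
  | 0, 1 => [:: (cyc_diff (gen Hv), 0%N)]
  | 0, 2 => [:: (hei_dz, 0%N)]
  | 1, 0 => [:: (hei_dzv, 0%N); (hei_zu, 1%N); ([:: (1, [::])], 2%N)]
  | 1, 1 => [:: (hei_dz, 0%N); (lneg (cyc_diff (gen Hu)), 2%N)]
  | 1, 2 => [:: (cyc_diff (gen Hv), 2%N); (lneg hei_dz, 1%N)]
  | 2, 0 => [:: (hei_dz, 0%N); (lneg hei_dzv, 1%N); (hei_zu, 2%N)]
  | _, _ => [::]
  end.

Lemma hei_d_out n j : (hei_rank n.+1 <= j)%N -> hei_d n j = [::].
Proof. by case: n j => [|[|[|n]]] [|[|[|j]]]. Qed.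

Notation mdH := (md RH hei_rank hei_d).

Definition hei_fox_gen (j : nat) : hei_gen := match j with 0 => Hu | 1 => Hv | _ => Hz end.

Definition hei_der (x : hei_gen) : seq (zl * nat) :=
  [:: ([:: (1, [::])], match x with Hu => 0 | Hv => 1 | Hz => 2 end%N)].

Lemma hei_i0 (j : 'I_(hei_rank 0)) : j = ord0.
Proof. exact: ord1. Qed.

Lemma hei_der_d x : mdH 0 (vec RH (hei_rank 1) (hei_der x) << 1%g >>) =
  << (wp (wgen x), ord0) >> - << (1%g, ord0) >>.
Proof.
rewrite (md_vec hei_d_out).
rewrite (@vec_eq _ _ _ hei_st _ _ _ [:: (cyc_diff (gen x), 0%N)] _ hei_nfP).
  rewrite /vec big_seq1 rl_diff rmulU mul1g raddfB /=.
  by rewrite !(inj_ord (ord0 : 'I_(hei_rank 0))).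
by case: x; vm_compute.
Qed.

Lemma hei_fox_gen_d (j : 'I_(hei_rank 1)) :
  vec RH (hei_rank 1) (hei_der (hei_fox_gen j)) << 1%g >> = << (1%g, j) >>.
Proof.
have -> : hei_der (hei_fox_gen j) = [:: ([:: (1, [::])], nat_of_ord j)].
  by case: j => [[|[|[|j]]] jP].
by rewrite /vec big_seq1 rl1 rmulU mulg1 inj_ord.
Qed.

Definition hei_rel_cells (i : nat) : seq (zl * nat) :=
  match i with
  | 0 => [:: ([:: (-1, [::])], 1%N)]
  | 1 => [:: ([:: (1, [::])], 2%N)]
  | _ => [:: ([:: (-1, [::])], 0%N)]
  end.

Lemma hei_rels_d q : q \in RH -> exists y, mdH 1 y =
  vec RH (hei_rank 1) (fox hei_der q.1) << 1%g >> -
  vec RH (hei_rank 1) (fox hei_der q.2) << 1%g >>.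
Proof.
move=> qR; pose i := index q RH.
have -> : q = nth ([::], [::]) RH i by rewrite nth_index.
exists (vec RH (hei_rank 2) (hei_rel_cells i) << 1%g >>); rewrite (md_vec hei_d_out).
have : (i < 3)%N by rewrite -[3%N]/(size RH) index_mem.
move: i => i i3; apply/eqP; rewrite eq_sym subr_eq -vec_cat eq_sym; apply/eqP.
apply: (vec_eq _ hei_nfP).
by move: i i3; do 3!(case; first by vm_compute).
Qed.

Lemma hei_dd n x : mdH n (mdH n.+1 x) = 0.
Proof.
rewrite [mdH n.+1 x](mdE hei_d_out) raddf_sum big1 // => j _; rewrite /= (md_vec hei_d_out).
apply: (vec0P hei_nfP).
case: j {x} => [j jP] /=; case: n jP => [|[|[|n]]] jP //.
- by move: j jP; do 3!(case; first by vm_compute).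
- by move: j jP; do 1!(case; first by vm_compute).
Qed.

(** Over the plane, where z acts trivially, row 0 makes the coordinate 0 invariant under translation
    by v; so it vanishes there and is a multiple of z - 1. A boundary clears it, and the injectivity
    of z - 1 clears the other two. *)
Lemma hei_exact2 x : mdH 1 x = 0 -> exists y, mdH 2 y = x.
Proof.
have row0 y : mdH 1 y = 0 -> rl RH hei_dzv (comp 0 y) + rl RH hei_dz (comp 1 y) = 0.
  move=> y0; have := @comp_md _ _ _ _ hei_d_out 1 0 y isT; rewrite y0 raddf0.
  by rewrite !big_ord_recl big_ord0 /= !big_cons !big_nil /= !addr0.
have row1 y : mdH 1 y = 0 -> rl RH hei_zu (comp 0 y) - rl RH hei_dz (comp 2 y) = 0.
  move=> y0; have := @comp_md _ _ _ _ hei_d_out 1 1 y isT; rewrite y0 raddf0.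
  by rewrite !big_ord_recl big_ord0 /= !big_cons !big_nil /= !addr0 rl_neg add0r => ->.
have dz_inj a : rl RH hei_dz a = 0 -> a = 0.
  by rewrite rl_diff => /eqP; rewrite subr_eq0 => /eqP /hei_z_kernel.
move=> x0; have [a aE] : coboundary (wp (gen Hz)) (comp 0 x).
  apply: hei_plane_kernel.
  apply: (@push_fixed _ (fun p : int * int => (p.1, p.2 + 1)) snd) => [[i j] [k l]|p|].
  - by move=> [-> /addIr ->].
  - by [].
  have := congr1 (push hei_plane) (row0 x x0); rewrite raddfD !rl_diff !raddfB raddf0 /=.
  rewrite /rmul !push_comp (eq_push hei_plane_z) subrr addr0 (eq_push hei_plane_zv).
  by move=> /eqP; rewrite subr_eq0 => /eqP.
exists (inj _ 0 a); apply/eqP; rewrite eq_sym -subr_eq0; apply/eqP.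
set x' := x - _; have x'0 : mdH 1 x' = 0 by rewrite raddfB /= x0 hei_dd subrr.
have c0 : comp 0 x' = 0.
  rewrite raddfB /= (md_inj hei_d_out) comp_vec // !big_cons big_nil /= addr0.
  by rewrite rl_diff aE subrr.
have c1 : comp 1 x' = 0 by apply: dz_inj; have := row0 _ x'0; rewrite c0 raddf0 add0r.
have c2 : comp 2 x' = 0.
  by apply: dz_inj; have /eqP := row1 _ x'0; rewrite c0 raddf0 sub0r oppr_eq0 => /eqP.
by apply: comp_eq0 => -[|[|[|]]].
Qed.

Lemma hei_exact3 x : mdH 2 x = 0 -> x = 0.
Proof.
move=> x0; apply: comp_eq0 => -[|//] _; apply: hei_z_kernel; apply/eqP.
have := @comp_md _ _ _ _ hei_d_out 2 0 x isT; rewrite x0 raddf0.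
rewrite !big_ord_recl big_ord0 /= !big_cons !big_nil /= !addr0 rl_diff.
by move=> /esym/eqP; rewrite subr_eq0.
Qed.

Definition hei_resolution : resolution Hei.
Proof.
exists (fun n => 'I_(hei_rank n)) (fun n => mdH n) (@deg (Hei * 'I_(hei_rank 0))%type).
- exact: md_eq.
- exact: deg_gact.
- exact: hei_dd.
- exact: (fox_aug hei_der_d hei_fox_gen_d).
- by move=> k; exists << k *g (1%g, ord0) >>; apply: degU.
- exact: (fox_exact0 hei_i0 hei_der_d).
- case=> [|[|[|n]]] x x0.
  + exact: (fox_exact1 hei_der_d hei_rels_d hei_fox_gen_d).
  + exact: hei_exact2.
  + by exists 0; rewrite raddf0 (hei_exact3 x0).
  + by exists 0; rewrite raddf0; apply/esym/comp_eq0.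
Defined.

End HeiResolution.

Arguments hei_rank : simpl never.

(** * Homology groups *)

Section CoinvariantCoordinates.
Variable r : nat.
Notation Z := {freeg 'I_r / int}.

Definition cof (i : nat) : Z -> int :=
  linext (fun j : 'I_r => if i == j then 1 else 0 : int^o).

Lemma cof_is_zmod_morphism i : zmod_morphism (cof i).
Proof. by move=> x y; exact: (@linext_is_zmod_morphism _ int^o). Qed.

HB.instance Definition _ i := GRing.isZmodMorphism.Build Z int (cof i) (cof_is_zmod_morphism i).

Lemma cofU i (j : 'I_r) : cof i << j >> = if i == j then 1 else 0.
Proof. exact: (@linextU _ int^o). Qed.

Lemma cof_out i y : (r <= i)%N -> cof i y = 0.
Proof.
move=> ri; move: y; apply: (@freeg_additive_ext _ _ (cof i) \0) => j.
by rewrite [LHS]cofU gtn_eqF // (leq_trans (ltn_ord j)).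
Qed.

Lemma cof_coeff (i : 'I_r) y : cof i y = coeff i y.
Proof.
move: y; apply: freeg_additive_ind => [|a b Ha Hb|j].
- by rewrite !raddf0.
- by rewrite !raddfB /= Ha Hb.
- by rewrite cofU coeffU mul1r eq_sym -val_eqE; case: eqP.
Qed.

Lemma cof_inj y : (forall i, (i < r)%N -> cof i y = 0) -> y = 0.
Proof. by move=> y0; apply/eqP/freeg_eqP => i; rewrite coeff0 -cof_coeff y0. Qed.

Lemma cof_ext x y : (forall i, (i < r)%N -> cof i x = cof i y) -> x = y.
Proof.
move=> xy; apply/eqP; rewrite -subr_eq0; apply/eqP/cof_inj => i ir.
by rewrite raddfB /= xy // subrr.
Qed.

Definition cvec (c : nat -> int) : Z := \sum_(j < r) c j *: (<< j >> : Z).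

Lemma cof_cvec i c : cof i (cvec c) = if (i < r)%N then c i else 0.
Proof.
rewrite raddf_sum; have [ir|ri] := ltnP i r.
  rewrite (bigD1 (Ordinal ir)) //= [X in _ + X]big1 ?addr0 => [|j ij].
    by rewrite (@additive_scalez _ int^o) /= cofU eqxx; apply: mulr1.
  rewrite (@additive_scalez _ int^o) /= cofU ifN ?scaler0 //.
  by rewrite eq_sym; exact: ij.
rewrite big1 // => j _; rewrite (@additive_scalez _ int^o) /= cofU ifN ?scaler0 //.
by rewrite gtn_eqF // (leq_trans (ltn_ord j)).
Qed.

Lemma cof_coinv (G : groupType) i (x : {freeg (G * 'I_r) / int}) :
  cof i (coinv x) = deg (comp i x).
Proof.
move: x; apply: (@freeg_additive_ext _ _ (cof i \o @coinv G _) (@deg G \o comp i)) => -[g j] /=.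
by rewrite coinvU cofU compU; case: eqP => _; rewrite ?degU ?deg0.
Qed.

End CoinvariantCoordinates.

Section Augmentation.
Variables (X : choiceType) (rels : seq (word X * word X)).

Definition zaug (a : seq (int * word X)) : int := foldr (fun p k => p.1 + k) 0 a.

Lemma deg_rl a x : deg (rl rels a x) = zaug a * deg x.
Proof.
rewrite rlE raddf_sum; elim: a => [|p a IH]; first by rewrite big_nil mul0r.
rewrite big_cons IH /= mulrDl degZ; congr (_ * _ + _).
move: x {IH}; apply: (@freeg_additive_ext _ _ (@deg (presented rels) \o rmul (wpi rels p.2))
  (@deg (presented rels))) => g /=.
by rewrite rmulU !degU.
Qed.

End Augmentation.

Section Hei4Coinvariants.
Notation RH4 := hei4_resolution.
Notation Z n := {freeg 'I_(hei4_rank n) / int}.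

(** On coinvariants each entry acts by its augmentation. As z - 1, t - 1, s - 1 and [fl] have
    augmentation 0, what survives is the norms, giving 4 and 2, and entries of the column cell. *)
Lemma cof_cd n i (y : Z n.+1) : (i < hei4_rank n)%N -> cof i (cd RH4 n y) =
  \sum_(j <- iota 0 (hei4_rank n.+1)) \sum_(e <- hei4_d n j | e.2 == i) zaug e.1 * cof j y.
Proof.
move=> ir; rewrite -[y](coinv_lift Hei4); set x := push _ y.
rewrite [cd _ _ _]cdE cof_coinv (comp_md hei4_d_out) // raddf_sum.
rewrite -[X in iota 0 X]subn0 -/(index_iota 0 _) big_mkord.
apply: eq_bigr => j _; rewrite raddf_sum; apply: eq_bigr => e _.
by rewrite /= deg_rl cof_coinv.
Qed.

Lemma cd4_0 (y : Z 1) : cd RH4 0 y = 0.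
Proof.
apply: cof_inj => -[|//] _; rewrite [LHS]cof_cd //.
by rewrite /= !big_cons !big_nil /=; lia.
Qed.

Lemma cd4_1 (y : Z 2) :
  [/\ cof 0 (cd RH4 1 y) = 4 * cof 0 y + 4 * cof 4 y,
      cof 1 (cd RH4 1 y) = - cof 4 y &
      cof 2 (cd RH4 1 y) = - 2 * cof 2 y + 4 * cof 4 y].
Proof. by split; rewrite [LHS]cof_cd // /= !big_cons !big_nil /=; lia. Qed.

Lemma cd4_2 (y : Z 3) :
  [/\ cof 0 (cd RH4 2 y) = 0,
      cof 1 (cd RH4 2 y) = - 4 * cof 1 y - cof 4 y,
      cof 2 (cd RH4 2 y) = 0,
      cof 3 (cd RH4 2 y) = 2 * cof 3 y - cof 4 y &
      cof 4 (cd RH4 2 y) = 0].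
Proof. by split; rewrite [LHS]cof_cd // /= !big_cons !big_nil /=; lia. Qed.

Lemma cd4_odd n (y : Z n.+4) : odd n.+3 ->
  [/\ cof 0 (cd RH4 n.+3 y) = 4 * cof 0 y,
      cof 1 (cd RH4 n.+3 y) = 0,
      cof 2 (cd RH4 n.+3 y) = - 2 * cof 2 y &
      cof 3 (cd RH4 n.+3 y) = 0].
Proof.
have r3 : (3 < hei4_rank n.+3)%N by case: (n).
rewrite /= negbK => on; split; rewrite [LHS]cof_cd ?(leq_trans _ r3) //.
all: by rewrite /= !big_cons !big_nil /= ?on /=; lia.
Qed.

Lemma cd4_even n (y : Z n.+4) : ~~ odd n.+3 ->
  [/\ cof 0 (cd RH4 n.+3 y) = 0,
      cof 1 (cd RH4 n.+3 y) = - 4 * cof 1 y,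
      cof 2 (cd RH4 n.+3 y) = 0 &
      cof 3 (cd RH4 n.+3 y) = 2 * cof 3 y].
Proof.
have r3 : (3 < hei4_rank n.+3)%N by case: (n).
rewrite /= negbK => on; split; rewrite [LHS]cof_cd ?(leq_trans _ r3) //.
all: by rewrite /= !big_cons !big_nil /= ?(negPf on) /=; lia.
Qed.

Lemma cd4_top n (y : Z n.+4) : cof 4 (cd RH4 n.+3 y) = 0.
Proof.
case: n y => [|n] y; last exact: cof_out.
by rewrite [LHS]cof_cd // /= !big_cons !big_nil /=; lia.
Qed.

Lemma hei4_rank_le n : (hei4_rank n <= 5)%N.
Proof. by case: n => [|[|[|[|n]]]]. Qed.

End Hei4Coinvariants.

Lemma Zp_intr_eq0 m (k : int) : (1 < m)%N -> (k%:~R : 'Z_m) = 0 -> exists q, k = q * m%:Z.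
Proof.
move=> m1; have natE n : (n%:R : 'Z_m) = 0 -> exists q, n = (q * m)%N.
  move=> /(congr1 val); rewrite /= val_Zp_nat // => /eqP nm.
  by exists (n %/ m)%N; rewrite {1}(divn_eq n m) (eqP nm) addn0.
case: k => n; first by rewrite -pmulrn => /natE[q ->]; exists q%:Z; rewrite PoszM.
rewrite NegzE mulrNz => /eqP; rewrite oppr_eq0 -pmulrn => /eqP /natE[q nE].
by exists (- q%:Z); rewrite nE PoszM mulNr.
Qed.

Lemma Zp_intr_mul m (k : int) : (1 < m)%N -> ((m%:Z * k)%:~R : 'Z_m) = 0.
Proof. by move=> m1; rewrite intrM -pmulrn pchar_Zp // mul0r. Qed.

Lemma Zp_intr_surj m (c : 'Z_m) : exists k : int, k%:~R = c.
Proof. by exists (Posz (nat_of_ord c)); rewrite -pmulrn natr_Zp. Qed.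

(** * The homology groups of Hei4, degree by degree *)

Section Hei4Homology.
Notation RH4 := hei4_resolution.
Notation Z n := {freeg 'I_(hei4_rank n) / int}.
Variable f : gmap idfun (bar_resolution Hei4) RH4.

Definition cof24 n (i j : nat) (y : Z n) : 'Z_2 * 'Z_4 := ((cof i y)%:~R, (cof j y)%:~R).

Lemma cof24_is_zmod_morphism n i j : zmod_morphism (@cof24 n i j).
Proof. move=> x y; by rewrite /cof24 !raddfB. Qed.

HB.instance Definition _ n i j :=
  GRing.isZmodMorphism.Build (Z n) ('Z_2 * 'Z_4)%type (@cof24 n i j)
    (@cof24_is_zmod_morphism n i j).

Lemma cof24_eq0 n i j (y : Z n) : cof24 i j y = 0 ->
  (exists q, cof i y = q * 2) /\ (exists q, cof j y = q * 4).
Proof. by case=> /(@Zp_intr_eq0 2 _ isT) ? /(@Zp_intr_eq0 4 _ isT). Qed.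

Lemma cof24_mul n i j (y : Z n) k l :
  cof i y = 2 * k -> cof j y = 4 * l -> cof24 i j y = 0.
Proof.
move=> ik jl; rewrite /cof24 ik jl.
by congr (_, _); [apply: (@Zp_intr_mul 2)|apply: (@Zp_intr_mul 4)].
Qed.

Lemma homology4_1 : zmod_iso (homology Hei4 1) ('Z_2 * 'Z_4)%type.
Proof.
have [|[c d]|x _ x0|th thb _] := homology_resolution f (n := 1) (xi := @cof24 1 2 0).
- move=> y; have [y0 y1 y2] := cd4_1 y.
  by apply: (cof24_mul (k := - cof 2 y + 2 * cof 4 y) (l := cof 0 y + cof 4 y));
     rewrite ?[LHS]y2 ?[LHS]y0; lia.
- have [[k <-] [l <-]] := (Zp_intr_surj c, Zp_intr_surj d).
  exists (cvec _ (fun i => if i == 2%N then k else l)); first exact: cd4_0.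
  by rewrite /= /cof24 !cof_cvec.
- have [[a aE] [b bE]] := cof24_eq0 x0.
  (* Row 1 forces the coordinate 4 of [y]; the coordinates 0 and 2 then absorb its contributions to
     the other rows. *)
  pose y : Z 2 := cvec _ (fun i => match i with
    | 0 => b + cof 1 x | 2 => - (a + 2 * cof 1 x) | 4 => - cof 1 x | _ => 0 end).
  exists y; have [y0 y1 y2] := cd4_1 y.
  apply: cof_ext => -[|[|[|//]]] _.
  + by rewrite [LHS]y0 bE !cof_cvec /=; lia.
  + by rewrite [LHS]y1 !cof_cvec /=; lia.
  + by rewrite [LHS]y2 aE !cof_cvec /=; lia.
by exists th.
Qed.

(** In odd degrees the cycle condition kills the coordinates 1 and 3, while boundaries fill the
    multiples of 4 in coordinate 0 and of 2 in coordinate 2. In even degrees the two pairs exchange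
    their roles. *)
Lemma homology4_odd n : odd n.+4 -> zmod_iso (homology Hei4 n.+4) ('Z_2 * 'Z_4)%type.
Proof.
move=> on; have on3 : ~~ odd n.+3 := on.
have [|[c d]|x xC x0|th thb _] := homology_resolution f (n := n.+4) (xi := @cof24 n.+4 2 0).
- move=> y; have [y0 y1 y2 y3] := @cd4_odd n.+1 y on.
  by apply: (cof24_mul (k := - cof 2 y) (l := cof 0 y)); rewrite ?[LHS]y2 ?[LHS]y0; lia.
- have [[k <-] [l <-]] := (Zp_intr_surj c, Zp_intr_surj d).
  pose x : Z n.+4 := cvec _ (fun i => match i with 0 => l | 2 => k | _ => 0 end).
  exists x; last by rewrite /= /cof24 !cof_cvec.
  have [y0 y1 y2 y3] := cd4_even x on3.
  apply: cof_inj => i ir; have : (i < 5)%N := leq_trans ir (hei4_rank_le _).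
  case: i {ir} => [|[|[|[|[|//]]]]] _; rewrite ?[LHS]y0 ?[LHS]y1 ?[LHS]y2 ?[LHS]y3 ?[LHS]cd4_top //.
  + by rewrite cof_cvec.
  + by rewrite cof_cvec.
- have [[a aE] [b bE]] := cof24_eq0 x0.
  have [z0 z1 z2 z3] := cd4_even x on3.
  rewrite [cd _ _ _]xC raddf0 in z1; rewrite [cd _ _ _]xC raddf0 in z3.
  pose y : Z n.+4.+1 := cvec _ (fun i => match i with 0 => b | 2 => - a | _ => 0 end).
  exists y; have [y0 y1 y2 y3] := @cd4_odd n.+1 y on.
  apply: cof_ext => i ir; have : (i < 5)%N := leq_trans ir (hei4_rank_le _).
  case: i {ir} => [|[|[|[|[|//]]]]] _; rewrite ?[LHS]y0 ?[LHS]y1 ?[LHS]y2 ?[LHS]y3.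
  + by rewrite bE !cof_cvec /=; lia.
  + by lia.
  + by rewrite aE !cof_cvec /=; lia.
  + by lia.
  + by rewrite !cof_out.
by exists th.
Qed.

Lemma homology4_even n : ~~ odd n.+4 -> zmod_iso (homology Hei4 n.+4) ('Z_2 * 'Z_4)%type.
Proof.
move=> on; have on3 : odd n.+3 := negbNE on.
have [|[c d]|x xC x0|th thb _] := homology_resolution f (n := n.+4) (xi := @cof24 n.+4 3 1).
- move=> y; have [y0 y1 y2 y3] := @cd4_even n.+1 y on.
  by apply: (cof24_mul (k := cof 3 y) (l := - cof 1 y)); rewrite ?[LHS]y3 ?[LHS]y1; lia.
- have [[k <-] [l <-]] := (Zp_intr_surj c, Zp_intr_surj d).
  pose x : Z n.+4 := cvec _ (fun i => match i with 1 => l | 3 => k | _ => 0 end).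
  exists x; last by rewrite /= /cof24 !cof_cvec.
  have [y0 y1 y2 y3] := cd4_odd x on3.
  apply: cof_inj => i ir; have : (i < 5)%N := leq_trans ir (hei4_rank_le _).
  case: i {ir} => [|[|[|[|[|//]]]]] _; rewrite ?[LHS]y0 ?[LHS]y1 ?[LHS]y2 ?[LHS]y3 ?[LHS]cd4_top //.
  + by rewrite cof_cvec.
  + by rewrite cof_cvec.
- have [[a aE] [b bE]] := cof24_eq0 x0.
  have [z0 z1 z2 z3] := cd4_odd x on3.
  rewrite [cd _ _ _]xC raddf0 in z0; rewrite [cd _ _ _]xC raddf0 in z2.
  pose y : Z n.+4.+1 := cvec _ (fun i => match i with 1 => - b | 3 => a | _ => 0 end).
  exists y; have [y0 y1 y2 y3] := @cd4_even n.+1 y on.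
  apply: cof_ext => i ir; have : (i < 5)%N := leq_trans ir (hei4_rank_le _).
  case: i {ir} => [|[|[|[|[|//]]]]] _; rewrite ?[LHS]y0 ?[LHS]y1 ?[LHS]y2 ?[LHS]y3.
  + by lia.
  + by rewrite bE !cof_cvec /=; lia.
  + by lia.
  + by rewrite aE !cof_cvec /=; lia.
  + by rewrite !cof_out.
by exists th.
Qed.

(** The column cell has boundary -1 in both coordinates 1 and 3, so only their difference survives;
    the boundaries -4 in coordinate 1 and 2 in coordinate 3 leave it modulo 2. *)
Definition cof_diff2 (y : Z 2) : 'Z_2 := (cof 1 y - cof 3 y)%:~R.

Lemma cof_diff2_is_zmod_morphism : zmod_morphism cof_diff2.
Proof.
move=> x y; rewrite /cof_diff2 -intrB; congr (_%:~R).
by rewrite ![cof _ (_ - _)]raddfB /=; ring.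
Qed.

HB.instance Definition _ :=
  GRing.isZmodMorphism.Build (Z 2) 'Z_2 cof_diff2 cof_diff2_is_zmod_morphism.

Lemma homology4_2 : zmod_iso (homology Hei4 2) 'Z_2.
Proof.
have [|c|x xC|th thb _] := homology_resolution f (n := 2) (xi := cof_diff2).
- move=> y; have [y0 y1 y2 y3 y4] := cd4_2 y; rewrite /= /cof_diff2.
  have -> : cof 1 (cd RH4 2 y) - cof 3 (cd RH4 2 y) = 2%:Z * (- 2 * cof 1 y - cof 3 y).
    by rewrite [cof 1 _]y1 [cof 3 _]y3; lia.
  exact: (@Zp_intr_mul 2).
- have [k <-] := Zp_intr_surj c.
  pose x : Z 2 := cvec _ (fun i => match i with 1 => k | _ => 0 end).
  exists x; last by rewrite /= /cof_diff2 !cof_cvec subr0.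
  have [y0 y1 y2] := cd4_1 x.
  apply: cof_inj => -[|[|[|//]]] _; rewrite ?[LHS]y0 ?[LHS]y1 ?[LHS]y2 !cof_cvec //.
- move=> /(@Zp_intr_eq0 2 _ isT)[q qE].
  have [z0 z1 z2] := cd4_1 x.
  rewrite [cd _ _ _]xC raddf0 in z0; rewrite [cd _ _ _]xC raddf0 in z1.
  rewrite [cd _ _ _]xC raddf0 in z2.
  pose y : Z 3 := cvec _ (fun i => match i with
    | 3 => - q | 4 => - 2 * q - cof 3 x | _ => 0 end).
  exists y; have [y0 y1 y2 y3 y4] := cd4_2 y.
  apply: cof_ext => -[|[|[|[|[|//]]]]] _.
  + by rewrite [LHS]y0; lia.
  + by rewrite [LHS]y1 !cof_cvec /=; lia.
  + by rewrite [LHS]y2; lia.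
  + by rewrite [LHS]y3 !cof_cvec /=; lia.
  + by rewrite [LHS]y4; lia.
by exists th.
Qed.

(** On cycles of degree 3, the coordinate on the column cell is [-4] times the
    coordinate [cof 1], which therefore parametrises the infinite summand.    *)
Definition cof3 (y : Z 3) : int * 'Z_2 * 'Z_4 := (cof 1 y, (cof 2 y)%:~R, (cof 0 y)%:~R).

Lemma cof3_is_zmod_morphism : zmod_morphism cof3.
Proof. by move=> x y; rewrite /cof3 !raddfB. Qed.

HB.instance Definition _ :=
  GRing.isZmodMorphism.Build (Z 3) (int * 'Z_2 * 'Z_4)%type cof3 cof3_is_zmod_morphism.

Lemma homology4_3 : exists2 th : {additive homology Hei4 3 -> (int * 'Z_2 * 'Z_4)%type},
  bijective th &
  forall c : cycles Hei4 3, th (\pi_(Quotient.quot (bar_boundary Hei4 3)) c)%qT =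
    cof3 (coinv_map (gm f 3) (val c)).
Proof.
apply: (homology_resolution f (n := 3) (xi := cof3)) => [y|[[m c] d]|x xC].
- have [y0 y1 y2 y3] := @cd4_odd 0 y isT.
  rewrite /= /cof3 [cof 1 _]y1 [cof 2 _]y2 [cof 0 _]y0; congr (_, _, _).
    have -> : - 2 * cof 2 y = 2%:Z * - cof 2 y by lia.
    exact: (@Zp_intr_mul 2).
  exact: (@Zp_intr_mul 4).
- have [[k <-] [l <-]] := (Zp_intr_surj c, Zp_intr_surj d).
  (* The last two values solve the cycle equations - 4 x_1 - x_4 = 0 and 2 x_3 - x_4 = 0. *)
  pose x : Z 3 := cvec _ (fun i => match i with
    | 0 => l | 1 => m | 2 => k | 3 => - 2 * m | _ => - 4 * m end).
  exists x; last by rewrite /= /cof3 !cof_cvec.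
  have [y0 y1 y2 y3 y4] := cd4_2 x.
  apply: cof_inj => -[|[|[|[|[|//]]]]] _;
    rewrite ?[LHS]y0 ?[LHS]y1 ?[LHS]y2 ?[LHS]y3 ?[LHS]y4 ?cof_cvec //=; lia.
- case=> x1 /(@Zp_intr_eq0 2 _ isT)[a aE] /(@Zp_intr_eq0 4 _ isT)[b bE].
  have [z0 z1 z2 z3 z4] := cd4_2 x.
  rewrite [cd _ _ _]xC raddf0 in z1; rewrite [cd _ _ _]xC raddf0 in z3.
  pose y : Z 4 := cvec _ (fun i => match i with 0 => b | 2 => - a | _ => 0 end).
  exists y; have [y0 y1 y2 y3] := @cd4_odd 0 y isT.
  have y4 : cof 4 (cd RH4 3 y) = 0 := cd4_top y.
  apply: cof_ext => -[|[|[|[|[|//]]]]] _.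
  + by rewrite [LHS]y0 bE !cof_cvec /=; lia.
  + by rewrite [LHS]y1; lia.
  + by rewrite [LHS]y2 aE !cof_cvec /=; lia.
  + by rewrite [LHS]y3; lia.
  + by rewrite [LHS]y4; lia.
Qed.

End Hei4Homology.

(** * The inclusion of Hei into Hei4 on third homology *)

Section HeiToHei4.
Notation RH := hei_resolution.
Notation RH4 := hei4_resolution.
Notation gen x := [:: (x, true)].
Notation zl4 := (seq (int * word hei4_gen)).

Lemma hei_cd3 (x : {freeg 'I_(hei_rank 3) / int}) : cd RH 2 x = 0.
Proof.
rewrite -[x](coinv_lift Hei); set y := push _ x.
rewrite [LHS]cdE; apply: cof_inj => i ir.
rewrite cof_coinv (comp_md hei_d_out) // raddf_sum big_ord_recl big_ord0 addr0 raddf_sum.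
case: i ir => [|[|[|//]]] _; rewrite /= !big_cons big_nil /= deg_rl /=; lia.
Qed.

Lemma homology_hei_3 (f : gmap idfun (bar_resolution Hei) RH) :
  exists2 th : {additive homology Hei 3 -> int}, bijective th &
  forall c : cycles Hei 3, th (\pi_(Quotient.quot (bar_boundary Hei 3)) c)%qT =
    cof 0 (coinv_map (gm f 3) (val c)).
Proof.
apply: (homology_resolution f (n := 3) (xi := cof 0)) => [y|c|x _ x0].
- have -> : y = 0 by apply: cof_inj.
  by rewrite !raddf0.
- exists (cvec _ (fun=> c)); first exact: hei_cd3.
  by rewrite /= cof_cvec.
- by exists 0; rewrite raddf0; apply/esym/cof_inj => -[|//] _.
Qed.

Definition hei_incl_zl (a : seq (int * word hei_gen)) : zl4 :=
  [seq (p.1, hei_incl_word p.2) | p <- a].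

Lemma hei_incl_wpi w : hei_incl (wpi hei_rels w) = wpi hei4_rels (hei_incl_word w).
Proof. by rewrite /hei_incl /= (presented_lift_pi hei_incl_rels) hei_incl_wordE. Qed.

Lemma push_incl_rl a x :
  push hei_incl (rl hei_rels a x) = rl hei4_rels (hei_incl_zl a) (push hei_incl x).
Proof.
rewrite !rlE big_map raddf_sum; apply: eq_bigr => p _.
rewrite additive_scalez /=; congr (_ *: _); rewrite /rmul !push_comp; apply: eq_push => g /=.
by rewrite gmulfM hei_incl_wpi.
Qed.

(** The explicit chain map over the inclusion; the coefficient [1] of the cell
    [1] in degree 3 makes [H_3] of [Hei] generate the free part.              *)
Definition hei_map_cells (n j : nat) : seq (zl4 * nat) :=
  let t := gen Gt in let v := gen Gv in
  let zv_zt := [:: (-1, [:: (Gz, true); (Gv, true)]); (-1, [:: (Gz, true); (Gt, true)])] in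
  match n, j with
  | 0, 0 => [:: ([:: (1, [::])], 0%N)]
  | 1, 0 => hei4_der Gu
  | 1, 1 => hei4_der Gv
  | 1, 2 => hei4_der Gz
  | 2, 0 => [:: ([:: (-1, [::])], 4%N); (zv_zt, 2%N); ([:: (1, gen Gz)], 0%N)]
  | 2, 1 => [:: ([:: (1, [::])], 3%N)]
  | 2, 2 => [:: ([:: (-1, t)], 3%N); (cyc_diff v, 1%N)]
  | 3, 0 => [:: (lneg (cyc_norm 4 [:: (Gu, true); (Gt, true)]), 4%N); (zv_zt, 3%N);
                ([:: (1, gen Gz)], 1%N)]
  | _, _ => [::]
  end.

Definition hei_map n : {freeg (Hei * 'I_(hei_rank n)) / int} ->
    {freeg (Hei4 * 'I_(hei4_rank n)) / int} :=
  eqext hei_incl (fun j : 'I_(hei_rank n) =>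
    vec hei4_rels (hei4_rank n) (hei_map_cells n j) << 1%g >>).

HB.instance Definition _ n := GRing.Additive.on (@hei_map n).

Lemma hei_map_inj n j x :
  hei_map (inj (hei_rank n) j x) =
  vec hei4_rels (hei4_rank n) (hei_map_cells n j) (push hei_incl x).
Proof.
have [jr|rj] := ltnP j (hei_rank n); last first.
  rewrite inj_out // raddf0 (_ : hei_map_cells n j = [::]) /vec ?big_nil //.
  by case: n j rj => [|[|[|[|n]]]] [|[|[|j]]].
move: x; apply: (@freeg_additive_ext _ _ (@hei_map n \o inj (hei_rank n) j)
  (vec hei4_rels (hei4_rank n) (hei_map_cells n j) \o push hei_incl)) => g /=.
by rewrite (inj_ord (Ordinal jr)) /hei_map eqextU pushU [RHS]vecU.
Qed.

Lemma hei_map_vec n l x : hei_map (vec hei_rels (hei_rank n) l x) =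
  vec hei4_rels (hei4_rank n)
    [seq (lmulz (hei_incl_zl e.1) f.1, f.2) | e <- l, f <- hei_map_cells n e.2]
    (push hei_incl x).
Proof.
rewrite raddf_sum /vec big_allpairs_dep; apply: eq_bigr => e _.
rewrite /= hei_map_inj push_incl_rl; apply: eq_bigr => f _; by rewrite rl_lmulz.
Qed.

Lemma hei_map_d n x : md hei4_rels hei4_rank hei4_d n (hei_map x) =
  hei_map (md hei_rels hei_rank hei_d n x).
Proof.
rewrite -[x](sum_inj_comp x) !raddf_sum; apply: eq_bigr => j _ /=.
rewrite hei_map_inj (md_vec hei4_d_out) (md_inj hei_d_out) hei_map_vec.
apply: (vec_eq _ hei4_nfP); case: j {x} => [j jr] /=.
by case: n jr => [|[|[|n]]] // jr; move: j jr; do ?[case=> // | vm_compute].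
Qed.

Definition hei_gmap : gmap hei_incl RH RH4.
Proof.
exists (fun n => @hei_map n : {additive {freeg (Hei * 'I_(hei_rank n)) / int} ->
    {freeg (Hei4 * 'I_(hei4_rank n)) / int}}) => [n|n|].
- exact: eqext_equivariant.
- exact: hei_map_d.
- apply: (@freeg_additive_ext _ _ (@deg (Hei4 * 'I_(hei4_rank 0))%type \o @hei_map 0)
    (@deg (Hei * 'I_(hei_rank 0))%type)) => -[g j] /=.
  rewrite [j]hei_i0 /hei_map eqextU deg_gact /= /vec big_seq1 rl1 rmulU mulg1.
  by rewrite (inj_ord (ord0 : 'I_(hei4_rank 0))) !degU.
Defined.

Lemma cof_hei_gmap (x : {freeg 'I_(hei_rank 3) / int}) :
  cof 1 (coinv_map (gm hei_gmap 3) x) = cof 0 x.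
Proof.
move: x; apply: (@freeg_additive_ext _ _ (cof 1 \o coinv_map (gm hei_gmap 3)) (cof 0)).
move=> j /=; rewrite coinv_mapU /= /hei_map eqext1 cof_coinv comp_vec //.
rewrite raddf_sum; case: j => [[|//] jP].
by rewrite /= !big_cons big_nil cofU /= deg_rl degU.
Qed.

End HeiToHei4.

Theorem theorem5p5 :
  [/\ forall n : nat, (1 <= n)%N -> n <> 2%N -> n <> 3%N ->
        zmod_iso (homology Hei4 n) ('Z_2 * 'Z_4)%type,
      zmod_iso (homology Hei4 2) 'Z_2,
      zmod_iso (homology Hei4 3) (int * 'Z_2 * 'Z_4)%type
    & let phi : {additive homology Hei 3 -> mod_torsion (homology Hei4 3)} :=
        @to_mod_torsion (homology Hei4 3) \o homology_map hei_incl 3 in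
      bijective phi].
Proof.
have [f] := gmap_exists idfun (bar_resolution Hei4) hei4_resolution.
have [g] := gmap_exists idfun (bar_resolution Hei) hei_resolution.
have [th th_bij thE] := homology4_3 f.
split.
- move=> [|[|[|[|n]]]] // _ _ _; first exact: homology4_1 f.
  by have [on|on] := boolP (odd n.+4); [apply: homology4_odd f _ on|apply: homology4_even f _ on].
- exact: homology4_2 f.
- by exists th.
have [thH thH_bij thHE] := homology_hei_3 g.
(* The ways from the bar resolution of Hei to [hei4_resolution] through the bar resolution of Hei4
   and through [hei_resolution] both cover the inclusion, hence agree on cycles up to a boundary. *)
have thM h : (th (homology_map hei_incl 3 h)).1.1 = thH h.
  elim/quotW: h => c; rewrite homology_map_pi thE thHE /=.
  pose fb : gmap hei_incl (bar_resolution Hei) hei4_resolution :=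
    @gmap_cast Hei Hei4 (idfun \o hei_incl) hei_incl (fun=> erefl) _ _
      (gmap_comp (bar_gmap hei_incl) f).
  pose gb : gmap hei_incl (bar_resolution Hei) hei4_resolution :=
    @gmap_cast Hei Hei4 (hei_incl \o idfun) hei_incl (fun=> erefl) _ _
      (gmap_comp g hei_gmap).
  have cC : ccycle (bar_resolution Hei) 3 (val c) by apply/ccycle_bar; case: (c).
  have [y] := gm_homotopic fb gb cC.
  rewrite [coinv_map (gm fb 3) _](coinv_map_comp (bar_gmap hei_incl) f).
  rewrite [coinv_map (gm gb 3) _](coinv_map_comp g hei_gmap).
  rewrite [coinv_map (gm (bar_gmap hei_incl) 3) _]coinv_bar_gmap => /(congr1 (cof 1)).
  (* Boundaries in degree 3 have coordinate 1 equal to 0, so homotopic maps agree exactly there. *)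
  have [_ -> _ _] := @cd4_odd 0 y isT.
  rewrite raddfB /= cof_hei_gmap => /esym/eqP; rewrite subr_eq0 => /eqP.
  exact.
(* Torsion is the kernel of the integer coordinate, since 4 kills Z/2 x Z/4. *)
have tors x : (x \in torsion (homology Hei4 3)) = ((th x).1.1 == 0).
  apply/asboolP/eqP => [[m [m_gt0 xm]]|x0].
    have : (th (x *+ m)).1.1 = 0 by rewrite xm raddf0.
    rewrite raddfMn => e; have : (th x).1.1 *+ m = 0.
      by rewrite -[RHS]e; elim: (m) => [//|k IH]; rewrite !mulrSr IH.
    by rewrite -mulr_natr natz => /eqP; rewrite mulf_eq0 => /orP[/eqP //|]; lia.
  exists 4%N; split=> //; apply: (bij_inj th_bij); rewrite raddfMn raddf0.
  case: (th x) x0 => [[a b] c] /= ->.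
  by congr (_, _, _); apply/val_inj; case: b c => [[|[|b]] bP] [[|[|[|[|c]]]] cP].
(* Modulo torsion, the integer coordinate identifies [phi] with the bijection [thH]. *)
move=> phi; apply: inj_surj_bijective => [x y|].
  rewrite /phi /= /to_mod_torsion => /eqP; rewrite -Quotient.idealrBE.
  rewrite -raddfB tors thM raddfB subr_eq0 => /eqP.
  exact: (bij_inj thH_bij).
elim/quotW=> x; have [k kK kK'] := thH_bij; exists (k (th x).1.1).
rewrite /phi /= /to_mod_torsion; apply/eqP; rewrite -Quotient.idealrBE tors raddfB /=.
by rewrite -[X in X == _]/((th _).1.1 - (th x).1.1) thM kK' subrr.
Qed.
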